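(* Consider an agent $i$ that at each time step $j=1,2,\ldots$ observes a pair $(x_{i,j},y_{i,j})$ generated by $y_{i,j}=\Theta x_{i,j}+\eta_{i,j}$, where $\Theta\in\mathbb{R}^{l\times n}$ is unknown, and $x_{i,j}\sim\mathcal{N}(\mu_{i,j},\sigma_x^2I_n)$, $\eta_{i,j}\sim\mathcal{N}(0,\sigma_\eta^2I_l)$ are Gaussian random vectors, all mutually independent over time, with deterministic means satisfying $\|\mu_{i,j}\|\le\hat{\mu}$ for all $j$ (here $\sigma_x>0$, $\sigma_\eta>0$, $\hat\mu\ge0$). Let $\hat{\Theta}_{i,t+1}=\big(\sum_{j=1}^t y_{i,j}x_{i,j}^*\big)\big(\sum_{j=1}^t x_{i,j}x_{i,j}^*\big)^{\dagger}$ be the local least-squares estimate. Fix $\delta>0$ and let $t\ge\max(t_1,t_2,t_3)$, where $t_1=8n+16\log\frac{2}{\delta}$, $t_2=\left(\frac{16\hat{\mu}(\sqrt{4n}+\sqrt{2\log\frac{2}{\delta}})}{\sigma_x}\right)^2$, $t_3=2(n+l)\log\frac{1}{\delta}$. Let $\bar{\mu}_{i,t}=\frac{4}{t\sigma_x^2}\sum_{j=1}^t\mu_{i,j}\mu_{i,j}^*$. Then with probability at least $1-4\delta$, $$\|\hat{\Theta}_{i,t+1}-\Theta\|\le\frac{C_1}{\sqrt{t}\,\sigma_x^2\,\lambda_{\min}(I_n+\bar{\mu}_{i,t})},$$ where $C_1=8\sigma_\eta\left(4\sigma_x\sqrt{(n+l)\log\frac{9}{\delta}}+\hat{\mu}\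big(\sqrt{2(l+n)}+2\sqrt{\log\frac{2}{\delta}}\big)\right)$.
   Context: $\|\cdot\|$ denotes the spectral norm, $A^*$ the (conjugate) transpose, $A^\dagger$ the pseudoinverse (equal to the inverse when $A$ is invertible), and $\lambda_{\min}$ the smallest eigenvalue (in magnitude). *)

(* Defs.v *)
From HB Require Import structures.
From mathcomp Require Import all_boot all_order all_algebra.
From mathcomp Require Import all_classical all_reals all_analysis.
Set Implicit Arguments. Unset Strict Implicit. Unset Printing Implicit Defensive.
Import Order.TTheory GRing.Theory Num.Theory.
Local Open Scope classical_set_scope.
Local Open Scope ring_scope.

Definition vnorm {R : realType} {q : nat} (v : 'cV[R]_q) : R :=
  Num.sqrt (\sum_(k < q) v k 0 ^+ 2).

Definition specnorm {R : realType} {p q : nat} (A : 'M[R]_(p, q)) : R :=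
  sup [set vnorm (A *m v) | v in [set v : 'cV[R]_q | vnorm v <= 1]].

(* Moore--Penrose conditions and the pseudoinverse (unique such matrix). *)
Definition penrose {R : realType} {p q : nat} (A : 'M[R]_(p, q)) (B : 'M[R]_(q, p)) : Prop :=
  [/\ A *m B *m A = A, B *m A *m B = B, (A *m B)^T = A *m B & (B *m A)^T = B *m A].

Definition pinv {R : realType} {p q : nat} (A : 'M[R]_(p, q)) : 'M[R]_(q, p) :=
  xget 0 [set B | penrose A B].

(* Smallest eigenvalue (for the real symmetric matrices used here). *)
Definition lambda_min {R : realType} {q : nat} (M : 'M[R]_q) : R :=
  inf [set a : R | eigenvalue M a].

Definition indep_RVs {R : realType} {d : measure_display} {T : measurableType d}
  {I : eqType} (P : probability T R) (Y : I -> {RV P >-> R}) : Prop :=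
  forall (s : seq I) (B : I -> set R), uniq s -> (forall i, measurable (B i)) ->
    P (\big[setI/setT]_(i <- s) (Y i @^-1` B i)) =
    (\prod_(i <- s) P (Y i @^-1` B i))%E.

Arguments indep_RVs {R d T I} P Y.

Definition coord_family {R : realType} {d : measure_display} {T : measurableType d}
  {P : probability T R} {n l : nat}
  (X : nat -> 'I_n -> {RV P >-> R}) (E : nat -> 'I_l -> {RV P >-> R}) :
  ((nat * 'I_n) + (nat * 'I_l))%type -> {RV P >-> R} :=
  fun i => match i with inl (j, k) => X j k | inr (j, m) => E j m end.

Definition xvec {R : realType} {d : measure_display} {T : measurableType d}
  {P : probability T R} {n : nat} (X : nat -> 'I_n -> {RV P >-> R}) (j : nat) (w : T)
  : 'cV[R]_n := \col_k X j k w.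

Definition yvec {R : realType} {d : measure_display} {T : measurableType d}
  {P : probability T R} {n l : nat} (Theta : 'M[R]_(l, n))
  (X : nat -> 'I_n -> {RV P >-> R}) (E : nat -> 'I_l -> {RV P >-> R}) (j : nat) (w : T)
  : 'cV[R]_l := Theta *m xvec X j w + xvec E j w.

(* Least-squares estimate from the first t samples (time indices 0..t-1). *)
Definition Thetahat {R : realType} {d : measure_display} {T : measurableType d}
  {P : probability T R} {n l : nat} (Theta : 'M[R]_(l, n))
  (X : nat -> 'I_n -> {RV P >-> R}) (E : nat -> 'I_l -> {RV P >-> R}) (t : nat) (w : T)
  : 'M[R]_(l, n) :=
  (\sum_(j < t) yvec Theta X E j w *m (xvec X j w)^T) *m
  pinv (\sum_(j < t) xvec X j w *m (xvec X j w)^T).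

Definition mubar {R : realType} {n : nat} (mu : nat -> 'cV[R]_n) (sx : R) (t : nat)
  : 'M[R]_n :=
  (4 / (t%:R * sx ^+ 2)) *: \sum_(j < t) mu j *m (mu j)^T.

(* Main.v *)
(* Write c_j = x_j - mu_j, W = sum_j x_j x_j^T, lambda = lambda_min(I + mubar) and
   Lambda = (t sx^2 / 32) lambda.  The estimation error is D = sum_j eta_j (W^-1 x_j)^T.

   Lower bound on W.  A Chernoff bound on the lattice directions of length at most
   5n in l^1, together with rounding of the unit sphere to that lattice, gives
   sum_j <c_j, v>^2 >= (5/32) t sx^2 |v|^2.  The cross terms <c_j, v> <mu_j, v> are at
   most (t sx^2 / 16) |v|^2 in total, by a chi-square bound on the Frobenius norm of
   sum_j c_j mu_j^T.  Hence <v, W v> >= Lambda |v|^2.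

   Upper bound on D.  Given the x_j, and since sum_j <W^-1 x_j, v>^2 <= |v|^2 / Lambda,
   each <u, D v> is centered Gaussian of variance at most se^2 |u|^2 |v|^2 / Lambda.  A union
   bound over lattice points whose convex hulls contain the unit balls bounds the
   operator norm of D, and a chi-square bound controls its Frobenius norm.  The first
   bound yields the sx-part of C1.  The second yields the muhat-part, because
   lambda <= 1 + 4 muhat^2 / (n sx^2): the factor n lost by the Frobenius norm is
   regained from the trace of mubar.

   All Gaussian moments come from integrating out one coordinate at a time. *)
Require Import Defs.
From HB Require Import structures.
From mathcomp Require Import all_boot all_order all_algebra.
From mathcomp Require Import all_classical all_reals all_analysis.
From mathcomp Require Import measurable_realfun ring lra.
Set Implicit Arguments. Unset Strict Implicit. Unset Printing Implicit Defensive.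
Import Order.TTheory GRing.Theory Num.Theory.
Local Open Scope classical_set_scope.
Local Open Scope ring_scope.

(** * Exponential moments of Gaussian families *)

Section integral_normal_prob.
Context {R : realType} (m s : R).
Local Notation leb := (@lebesgue_measure R).

(** The claim divides by lambda, while the conditional deviation of <u, D v> only supplies
    sqrt(Lambda), hence sqrt(lambda). The missing factor is at most 1 + 2 muhat / (sqrt n sx). Its
    summand 1 is paid by the operator bound, its second summand by the Frobenius bound, whose sqrt n
    cancels; this is why C1 is a sum and D is estimated twice.

    Rounding to a lattice replaces the usual net argument because it compares a quadratic form at a
    unit vector with lattice values at a cost governed by the trace alone, so no operator norm bound
    for sum_j c_j c_j^T is needed. Each coordinate goes to a neighbour chosen so that the
    first-order error does no harm, and a quarter of the squared mesh times the trace is lost. With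
    mesh 1 / (4 sqrt n) and trace at most 2 n t sx^2 the loss is t sx^2 / 32: the constant 3/16 at
    lattice points becomes 5/32 on the sphere. The cross terms enter twice, with 1/16 each, and
    leave the 1/32 of Lambda. *)

Lemma ge0_integral_normal_prob (f : measurableTypeR R -> \bar R) :
  measurable_fun setT f -> (forall x, 0 <= f x)%E ->
  (\int[normal_prob m s]_x f x = \int[leb]_x (f x * (normal_pdf m s x)%:E))%E.
Proof.
move=> mf f0.
have dom := normal_prob_dominates m s.
rewrite -(@Radon_Nikodym_SigmaFinite.change_of_variables _ _ _ (normal_prob m s) leb dom f setT f0 measurableT mf).
have mg : measurable_fun setT (Radon_Nikodym_SigmaFinite.f (normal_prob m s) leb).
  exact: measurable_int (Radon_Nikodym_SigmaFinite.f_integrable dom).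
have mp : measurable_fun setT (fun x => (normal_pdf m s x)%:E).
  by apply/measurable_EFinP; exact: measurable_normal_pdf.
apply: ae_eq_integral => //; [exact: emeasurable_funM..|].
apply: ae_eqe_mul2l; apply: integral_ae_eq => //.
  exact: Radon_Nikodym_SigmaFinite.f_integrable.
by move=> E _ mE; rewrite -Radon_Nikodym_SigmaFinite.f_integral.
Qed.

Lemma integral_cst_normal_pdf (K : R) : 0 <= K ->
  (\int[leb]_x (K * normal_pdf m s x)%:E = K%:E)%E.
Proof.
move=> K0; under eq_integral do rewrite EFinM.
rewrite ge0_integralZl//=.
- by rewrite integral_normal_pdf mule1.
- by apply/measurable_EFinP; exact: measurable_normal_pdf.
- by move=> x _; rewrite lee_fin normal_pdf_ge0.
Qed.

End integral_normal_prob.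

Section normal_exponential_moments.
Context {R : realType} (m s : R).

Lemma normal_mgf (c : R) : s != 0 ->
  (\int[normal_prob m s]_x (expR (c * (x - m)))%:E =
   (expR (c ^+ 2 * s ^+ 2 / 2))%:E)%E.
Proof.
move=> s0; rewrite ge0_integral_normal_prob; first last.
- by move=> x; rewrite lee_fin expR_ge0.
- apply/measurable_EFinP; apply: measurableT_comp => //.
  by apply: measurable_funM => //; exact: measurable_funB.
(* Completing the square turns the tilted density into a constant times the density with mean
   shifted by [c * s ^+ 2]. *)
rewrite -(integral_cst_normal_pdf (m + c * s ^+ 2) s); last exact: expR_ge0.
apply: eq_integral => x _; rewrite -!EFinM; congr EFin.
rewrite !normal_pdfE// /normal_fun [LHS]mulrCA [RHS]mulrCA -!expRD; congr (_ * expR _).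
by field.
Qed.

(** A quadratic tilt of a Gaussian is again Gaussian, with variance [s ^+ 2 / u]; the ratio of the
    peaks gives [u] to the power -1/2. Powers of [u] are written with [expR] and [ln] so that the
    factors of many coordinates merge into one exponent. *)
Lemma normal_quad_mgf (th b a : R) : s != 0 -> 2 * th * b ^+ 2 * s ^+ 2 < 1 ->
  let u := 1 - 2 * th * b ^+ 2 * s ^+ 2 in
  (\int[normal_prob m s]_x (expR (th * (a + b * (x - m)) ^+ 2))%:E =
   (expR (- ln u / 2) * expR (th * expR (- ln u) * a ^+ 2))%:E)%E.
Proof.
move=> s0 lt1 u.
have u0 : 0 < u by rewrite subr_gt0.
rewrite ge0_integral_normal_prob; first last.
- by move=> x; rewrite lee_fin expR_ge0.
- apply/measurable_EFinP; apply: measurableT_comp => //.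
  apply: measurable_funM => //; apply: measurable_funX; apply: measurable_funD => //.
  by apply: measurable_funM => //; exact: measurable_funB.
have uE : expR (- ln u) = u^-1 by rewrite expRN lnK.
pose s' := s * expR (- ln u / 2).
have s'0 : s' != 0 by rewrite mulf_neq0// gt_eqF// expR_gt0.
have s'2 : s' ^+ 2 = s ^+ 2 / u.
  rewrite exprMn -expRM_natl -uE; congr (_ * expR _); by field.
rewrite -(integral_cst_normal_pdf (m + 2 * th * a * b * s' ^+ 2) s'); last first.
  by rewrite mulr_ge0// expR_ge0.
apply: eq_integral => x _; rewrite -!EFinM; congr EFin.
have peakE : normal_peak s' = normal_peak s * expR (ln u / 2).
  rewrite /normal_peak s'2.
  have -> : s ^+ 2 / u * pi *+ 2 = (s ^+ 2 * pi *+ 2) / u.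
    by rewrite mulrnAl [in LHS]mulrAC.
  have w0 : 0 <= s ^+ 2 * pi *+ 2.
    exact: mulrn_wge0 2 (mulr_ge0 (sqr_ge0 s) (pi_ge0 R)).
  rewrite (sqrtrM _ w0).
  rewrite invfM; congr (_ * _); rewrite sqrtrV ?ltW// invrK -[in LHS](lnK u0).
  have -> : ln u = ln u / 2 + ln u / 2 by field.
  by rewrite expRD -expr2 sqrtr_sqr ger0_norm ?expR_ge0//; congr expR; field.
rewrite !normal_pdfE// /normal_fun peakE s'2 uE.
have -> (p q r z w : R) : expR z * expR q * (p * expR w * expR r) =
   p * expR (z + q + w + r) by rewrite !expRD; ring.
rewrite [LHS]mulrCA -expRD; congr (_ * expR _).
rewrite /u; field; rewrite s0/= gt_eqF//.
Qed.

End normal_exponential_moments.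

(** * Conditioning on a sigma-algebra independent of one variable *)

Section freezing.
Context {R : realType} {d : measure_display} {T : measurableType d}.
Variables (P : probability T R) (G : set (set T)).
Hypothesis GS : G `<=` measurable.
Hypothesis GI : setI_closed G.
Hypothesis GT : G setT.
Let TG := g_sigma_algebraType G.

Lemma sub_g_sigma_algebra_measurable (A : set T) : @measurable _ TG A -> measurable A.
Proof.
by apply: smallest_sub => //; exact: sigma_algebra_measurable.
Qed.

Lemma measurable_fun_g_sigma_algebra d' (U : measurableType d') (f : T -> U) :
  measurable_fun setT (f : TG -> U) -> measurable_fun setT f.
Proof.
move=> mf _ B mB; apply: sub_g_sigma_algebra_measurable; exact: (mf measurableT).
Qed.

Variables (Y : {RV P >-> R}) (N : probability R R).
Hypothesis YN : forall B, measurable B -> P (Y @^-1` B) = N B.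
Hypothesis GY : forall A B, G A -> measurable B ->
  P (A `&` Y @^-1` B) = (P A * P (Y @^-1` B))%E.

Let idG : T -> TG := id.
Let midG : measurable_fun setT idG.
Proof. by move=> _ B mB; rewrite setTI; exact: sub_g_sigma_algebra_measurable. Qed.

Let pairY (w : T) : TG * R := (idG w, Y w).
Let mpairY : measurable_fun setT pairY.
Proof. exact: measurable_fun_pair. Qed.


Let idGm : {mfun T >-> TG} := mfun_Sub (mem_set midG).
Let PG : probability TG R := distribution P idGm.

Let indepG A B : @measurable _ TG A -> measurable B ->
  P (A `&` Y @^-1` B) = (P A * N B)%E.
Proof.
move=> mA mB.
have mYB : measurable (Y @^-1` B) by rewrite -[X in measurable X]setTI; exact: measurable_funPT.
have NB0 : 0 <= fine (N B) by exact: fine_ge0.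
pose m1 : {measure set TG -> \bar R} := pushforward (mrestr P mYB) idGm.
pose m2 : {measure set TG -> \bar R} := mscale (NngNum NB0) PG.
have NBE : (fine (N B))%:E = N B by rewrite fineK// fin_num_measure.
have m2E C : m2 C = (P C * N B)%E by rewrite muleC -[in RHS]NBE.
rewrite -m2E -[LHS]/(m1 midG A).
have := @measure_unique _ R TG G (fun=> setT) erefl GI (fun=> GT).
move=> /(_ _ (m1 midG) m2); apply => //.
- by rewrite bigcup_const.
- by move=> C GC; rewrite m2E -YN// -GY.
- by move=> k; rewrite /m1/= /pushforward /mrestr/= preimage_setT setTI YN// -NBE ltry.
Qed.

Let pairYm : {mfun T >-> (TG * R)%type} := mfun_Sub (mem_set mpairY).

(** The identity, seen as a map into [T] with the coarser sigma-algebra generated by [G], is paired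
    with [Y]. A pi-system argument extends [GY] from [G] to that sigma-algebra, so the joint law is
    a product measure and Tonelli integrates [Y] out with [w] held fixed. *)
Lemma freezing (f : T * R -> \bar R) :
  measurable_fun setT (f : TG * R -> \bar R) -> (forall z, 0 <= f z)%E ->
  (\int[P]_w f (w, Y w) = \int[P]_w \int[N]_y f (w, y))%E.
Proof.
move=> mf f0.
have E A : measurable A -> (PG \x N)%E A = distribution P pairYm A.
  by apply: product_measure_unique.
transitivity (\int[distribution P pairYm]_z f z)%E.
  by rewrite ge0_integral_distribution.
rewrite (eq_measure_integral (PG \x N)%E); last by move=> A mA _; apply/esym; exact: E.
rewrite fubini_tonelli1// /fubini_F.
rewrite ge0_integral_distribution//.
- exact: measurable_fun_fubini_tonelli_F.
- by move=> x; exact: integral_ge0.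
Qed.

End freezing.

Lemma measurable_sum_seq {d} {T : measurableType d} {R : realType} {I : eqType}
    (s : seq I) (h : I -> T -> R) :
  (forall i, i \in s -> measurable_fun setT (h i)) ->
  measurable_fun setT (fun w => \sum_(i <- s) h i w).
Proof.
elim: s => [|i s IH] mh; first by under eq_fun do rewrite big_nil; exact: measurable_cst.
under eq_fun do rewrite big_cons.
apply: measurable_funD; first by apply: mh; rewrite mem_head.
by apply: IH => j js; apply: mh; rewrite inE js orbT.
Qed.

(** A pi-system generating the sigma-algebra of the coordinates in [s], in exactly the shape for
    which [indep_RVs] gives a product formula. *)
Definition rectangles {R : realType} {d : measure_display} {T : measurableType d}
    {P : probability T R} {I : eqType} (Y : I -> {RV P >-> R}) (s : seq I) : set (set T) :=
  [set A | exists2 B : I -> set R, (forall i, measurable (B i)) &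
    A = \big[setI/setT]_(i <- s) (Y i @^-1` B i)].

Definition generated {R : realType} {d : measure_display} {T : measurableType d}
    {P : probability T R} {I : eqType} (Y : I -> {RV P >-> R}) (s : seq I) :=
  g_sigma_algebraType (rectangles Y s).

(** * Gaussian moments with coefficients depending on other coordinates *)

Section gaussian_family.
Context {R : realType} {d : measure_display} {T : measurableType d}
  {P : probability T R} {I : choiceType} (Y : I -> {RV P >-> R}).

Lemma rectangles_measurable s : rectangles Y s `<=` measurable.
Proof.
move=> _ [B mB ->]; elim/big_ind: _ => //; first by move=> ? ? ? ?; exact: measurableI.
by move=> i _; rewrite -[X in measurable X]setTI; exact: measurable_funPT.
Qed.

Lemma rectangles_setI s : setI_closed (rectangles Y s).
Proof.
move=> _ _ [B mB ->] [C mC ->]; exists (fun i => B i `&` C i).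
  by move=> i; exact: measurableI.
by rewrite -big_split; apply: eq_bigr => i _; rewrite preimage_setI.
Qed.

Lemma rectangles_setT s : rectangles Y s setT.
Proof. by exists (fun=> setT) => //; rewrite big1. Qed.

Lemma rectangles_sub s s' : {subset s <= s'} -> rectangles Y s `<=` rectangles Y s'.
Proof.
move=> ss' _ [B mB ->]; exists (fun i => if i \in s then B i else setT).
  by move=> i; case: ifP.
rewrite -!bigcap_seq; apply/seteqP; split => w /= h i.
  by case: ifPn => // iS _; exact: h.
by move=> iS; have := h _ (ss' _ iS); rewrite iS.
Qed.

Lemma measurable_generated_sub s s' d' (U : measurableType d') (f : T -> U) :
  {subset s <= s'} -> measurable_fun setT (f : generated Y s -> U) ->
  measurable_fun setT (f : generated Y s' -> U).
Proof.
move=> ss' mf _ B mB; have := mf measurableT B mB.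
apply: (sub_smallest2r _ (rectangles_sub ss')).
exact: smallest_sigma_algebra.
Qed.

Lemma measurable_generated s d' (U : measurableType d') (f : T -> U) :
  measurable_fun setT (f : generated Y s -> U) -> measurable_fun setT f.
Proof. by apply: measurable_fun_g_sigma_algebra; exact: rectangles_measurable. Qed.

Lemma measurable_coordinate s i : i \in s ->
  measurable_fun setT (Y i : generated Y s -> R).
Proof.
move=> iS _ B mB; rewrite setTI; apply: sub_sigma_algebra.
exists (fun j => if j == i then B else setT); first by move=> j; case: ifP.
rewrite -bigcap_seq; apply/seteqP; split => w /= h.
  by move=> j _; case: ifPn => // /eqP ->.
by have := h _ iS; rewrite eqxx.
Qed.

Variables (m sg : I -> R).
Hypothesis sg0 : forall i, sg i != 0.
Hypothesis YN : forall i A, measurable A ->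
  distribution P (Y i) A = normal_prob (m i) (sg i) A.
Hypothesis Yind : indep_RVs P Y.

Lemma freeze_coordinate s i (f : T * R -> \bar R) : uniq (i :: s) ->
  measurable_fun setT (f : generated Y s * R -> \bar R) -> (forall z, 0 <= f z)%E ->
  (\int[P]_w f (w, Y i w) = \int[P]_w \int[normal_prob (m i) (sg i)]_y f (w, y))%E.
Proof.
move=> us mf f0.
(* [normal_prob] lives on [measurableTypeR R]; its image under the identity is the same law on [R],
   as [freezing] expects. *)
pose idTR : measurableTypeR R -> R := id.
have midTR : measurable_fun setT idTR by exact: (@measurable_id _ _ setT).
pose N : probability R R := distribution (normal_prob (m i) (sg i)) (mfun_Sub (mem_set midTR)).
transitivity (\int[P]_w \int[N]_y f (w, y))%E; last first.
  apply: eq_integral => w _; rewrite ge0_integral_distribution//.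
  have mp : measurable_fun setT (fun y : R => (w : generated Y s, y)) by exact: measurable_fun_pair.
  exact: (measurableT_comp mf mp).
apply: (@freezing R d T P (rectangles Y s)) => //.
- exact: rectangles_measurable.
- exact: rectangles_setI.
- exact: rectangles_setT.
- by move=> B mB; exact: YN.
move=> _ B [C mC ->] mB.
have /andP[iS _] := us.
pose D j := if j == i then B else C j.
have mD j : measurable (D j) by rewrite /D; case: ifP.
have DE : \big[setI/setT]_(j <- s) (Y j @^-1` D j) =
          \big[setI/setT]_(j <- s) (Y j @^-1` C j).
  by apply: eq_big_seq => j js; rewrite /D; case: eqP js iS => // -> ->.
have Di : D i = B by rewrite /D eqxx.
have us' : uniq s by case/andP: us.
have := Yind us mD; rewrite !big_cons DE Di setIC => ->.
rewrite (Yind us' mC) muleC; congr (_ * _)%E.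
by apply: eq_big_seq => j js; rewrite /D; case: eqP js iS => // -> ->.
Qed.

Let Z i w := Y i w - m i.

(** The coefficients see only the coordinates in [s], so each coordinate of [r] can be frozen and
    integrated. The factor it produces again depends on [s] alone and is stored in [psi], which
    makes the induction close. *)
Lemma gaussian_linear_mgf s r (c : I -> T -> R) (psi : T -> R) :
  uniq (r ++ s) ->
  (forall i, measurable_fun setT (c i : generated Y s -> R)) ->
  measurable_fun setT (psi : generated Y s -> R) -> (forall w, 0 <= psi w) ->
  (\int[P]_w (psi w * expR (\sum_(i <- r) c i w * Z i w))%:E =
   \int[P]_w (psi w * expR (\sum_(i <- r) c i w ^+ 2 * sg i ^+ 2 / 2))%:E)%E.
Proof.
elim: r psi => [|i r IH] psi u mc mpsi psi0.
  by apply: eq_integral => w _; rewrite !big_nil.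
have sub : {subset s <= r ++ s} by move=> j; rewrite mem_cat orbC => ->.
have mc' j := measurable_generated_sub sub (mc j).
have mpsi' := measurable_generated_sub sub mpsi.
pose f (z : generated Y (r ++ s) * R) : \bar R :=
  (psi z.1 * expR (\sum_(i <- r) c i z.1 * Z i z.1) * expR (c i z.1 * (z.2 - m i)))%:E.
transitivity (\int[P]_w f (w, Y i w))%E.
  by apply: eq_integral => w _; rewrite /f/= big_cons -mulrA -expRD addrC.
rewrite (@freeze_coordinate (r ++ s)) => //; last 2 first.
- apply/measurable_EFinP; apply: measurable_funM; last first.
    apply: measurableT_comp => //; apply: measurable_funM.
      exact: measurableT_comp (mc' i) (measurable_fst).
    by apply: measurable_funB.
  pose g (w : generated Y (r ++ s)) := psi w * expR (\sum_(i <- r) c i w * Z i w).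
  have mg : measurable_fun setT g.
    apply: measurable_funM => //; apply: measurableT_comp => //.
    apply: measurable_sum_seq => j jr; apply: measurable_funM => //.
    by apply: measurable_funB => //; apply: measurable_coordinate; rewrite mem_cat jr.
  exact: measurableT_comp mg (measurable_fst).
- by move=> z; rewrite lee_fin !mulr_ge0 ?expR_ge0.
transitivity (\int[P]_w ((psi w * expR (c i w ^+ 2 * sg i ^+ 2 / 2)) *
    expR (\sum_(i <- r) c i w * Z i w))%:E)%E.
  apply: eq_integral => w _; rewrite /f /=.
  under eq_integral do rewrite EFinM.
  rewrite ge0_integralZl//=.
  - by rewrite normal_mgf// -EFinM mulrAC.
  - apply/measurable_EFinP; apply: measurableT_comp => //.
    by apply: measurable_funM => //; exact: measurable_funB.
  - by rewrite lee_fin mulr_ge0// expR_ge0.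
rewrite (IH (fun w => psi w * expR (c i w ^+ 2 * sg i ^+ 2 / 2))).
- by apply: eq_integral => w _; rewrite big_cons expRD mulrA.
- by case/andP: u.
- by [].
- apply: measurable_funM => //; apply: measurableT_comp => //.
  by apply: measurable_funM => //; apply: measurable_funM => //; exact: measurable_funX.
- by move=> w; rewrite mulr_ge0// expR_ge0.
Qed.

(** Integrating one coordinate replaces [th] by [th / q] with [q] depending on [w], hence [th] is a
    function. The factors telescope, since [q] times the new argument of [ln] is the old one, and
    only the total variance of the row survives. [th] may have either sign; lower tails use negative
    values. *)
Lemma gaussian_quadratic_mgf s r (th : T -> R) (b : I -> T -> R) (psi : T -> R) :
  uniq (r ++ s) ->
  measurable_fun setT (th : generated Y s -> R) ->
  (forall i, measurable_fun setT (b i : generated Y s -> R)) ->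
  measurable_fun setT (psi : generated Y s -> R) -> (forall w, 0 <= psi w) ->
  (forall w, 2 * th w * \sum_(i <- r) b i w ^+ 2 * sg i ^+ 2 < 1) ->
  (\int[P]_w (psi w * expR (th w * (\sum_(i <- r) b i w * Z i w) ^+ 2))%:E =
   \int[P]_w (psi w * expR (- ln (1 - 2 * th w * \sum_(i <- r) b i w ^+ 2 * sg i ^+ 2) / 2))%:E)%E.
Proof.
elim: r th psi => [|i r IH] th psi u mth mb mpsi psi0 lt1.
  by apply: eq_integral => w _; rewrite !big_nil expr0n/= mulr0 mulr0 subr0 ln1 oppr0 mul0r.
have sub : {subset s <= r ++ s} by move=> j; rewrite mem_cat orbC => ->.
have mb' j := measurable_generated_sub sub (mb j).
have mpsi' := measurable_generated_sub sub mpsi.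
have mth' := measurable_generated_sub sub mth.
pose S w := \sum_(i <- r) b i w * Z i w.
pose V w := \sum_(i <- r) b i w ^+ 2 * sg i ^+ 2.
have V0 w : 0 <= V w by apply: sumr_ge0 => j _; rewrite mulr_ge0 ?sqr_ge0.
have mS : measurable_fun setT (S : generated Y (r ++ s) -> R).
  apply: measurable_sum_seq => j jr; apply: measurable_funM => //.
  by apply: measurable_funB => //; apply: measurable_coordinate; rewrite mem_cat jr.
pose f (z : generated Y (r ++ s) * R) : \bar R :=
  (psi z.1 * expR (th z.1 * (S z.1 + b i z.1 * (z.2 - m i)) ^+ 2))%:E.
transitivity (\int[P]_w f (w, Y i w))%E.
  by apply: eq_integral => w _; rewrite /f/= big_cons addrC.
have c1 (g : generated Y (r ++ s) -> R) : measurable_fun setT g ->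
    measurable_fun setT (fun z : generated Y (r ++ s) * R => g z.1).
  by move=> mg; exact: measurableT_comp mg (measurable_fst).
rewrite (@freeze_coordinate (r ++ s)) => //; last 2 first.
- apply/measurable_EFinP; apply: measurable_funM; first exact: c1.
  apply: measurableT_comp => //; apply: measurable_funM; first exact: c1.
  apply: measurable_funX; apply: measurable_funD; first exact: c1.
  apply: measurable_funM; first exact: c1.
  exact: measurable_funB.
- by move=> z; rewrite lee_fin !mulr_ge0 ?expR_ge0.
pose q w := 1 - 2 * th w * b i w ^+ 2 * sg i ^+ 2.
have lt1' w : 2 * th w * (b i w ^+ 2 * sg i ^+ 2) + 2 * th w * V w < 1.
  by have := lt1 w; rewrite big_cons mulrDr.
have q0 w : 0 < q w.
  rewrite subr_gt0 -mulrA; move: (lt1' w) (V0 w).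
  have : 0 <= b i w ^+ 2 * sg i ^+ 2 by rewrite mulr_ge0 ?sqr_ge0.
  move: (b i w ^+ 2 * _) (V w) (th w) => x y z x0 h y0.
  have [z0|/ltW z0] := leP 0 z.
    by have := mulr_ge0 z0 y0; lra.
  by have := mulr_le0_ge0 z0 x0; lra.
pose th' w := th w * expR (- ln (q w)).
have th'E w : th' w = th w / q w by rewrite /th' expRN lnK// posrE.
have mq : measurable_fun setT (q : generated Y s -> R).
  apply: measurable_funB => //; apply: measurable_funM => //.
  apply: measurable_funM; last exact: measurable_funX.
  exact: measurable_funM.
have mlq : measurable_fun setT ((fun w => - ln (q w)) : generated Y s -> R).
  by apply: measurableT_comp => //; apply: measurableT_comp.
transitivity (\int[P]_w ((psi w * expR (- ln (q w) / 2)) * expR (th' w * S w ^+ 2))%:E)%E.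
  apply: eq_integral => w _; rewrite /f /=.
  under eq_integral do rewrite EFinM.
  rewrite ge0_integralZl//=.
  - rewrite normal_quad_mgf//.
      by rewrite -EFinM mulrA.
    by rewrite -subr_gt0; exact: q0.
  - apply/measurable_EFinP; apply: measurableT_comp => //.
    apply: measurable_funM => //; apply: measurable_funX; apply: measurable_funD => //.
    by apply: measurable_funM => //; exact: measurable_funB.
  - by rewrite lee_fin.
have lt1'' w : 2 * th' w * V w < 1.
  rewrite th'E mulrA mulrAC ltr_pdivrMr// mul1r /q ltrBrDl addrC -!mulrA.
  by have := lt1' w; rewrite -!mulrA addrC.
rewrite (IH th' (fun w => psi w * expR (- ln (q w) / 2))).
- apply: eq_integral => w _; rewrite -mulrA -expRD big_cons -/(V w); congr (_ * expR _)%:E.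
  have qn0 : q w != 0 by rewrite gt_eqF.
  have -> : 1 - 2 * th w * (b i w ^+ 2 * sg i ^+ 2 + V w) = q w * (1 - 2 * th' w * V w).
    by rewrite th'E mulrBr mulr1 /q; field.
  have -> : ln (q w * (1 - 2 * th' w * V w)) = ln (q w) + ln (1 - 2 * th' w * V w).
    by apply: lnM; rewrite posrE// subr_gt0.
  by rewrite -mulrDl -opprD.
- by case/andP: u.
- by apply: measurable_funM => //; apply: measurableT_comp.
- by [].
- by apply: measurable_funM => //; apply: measurableT_comp => //; apply: measurable_funM.
- by move=> w; rewrite mulr_ge0// expR_ge0.
- exact: lt1''.
Qed.

End gaussian_family.

(** * Chernoff and Jensen inequalities *)

Section exponential_markov.
Context {R : realType} {d : measure_display} {T : measurableType d} (P : probability T R).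

Lemma integral_probability_cst (c : \bar R) : (\int[P]_w c = c)%E.
Proof. by rewrite integral_cst//= probability_setT mule1. Qed.

Lemma measurable_superlevel (f : T -> R) (a : R) : measurable_fun setT f ->
  measurable [set w | a <= f w].
Proof.
move=> mf; rewrite -[X in measurable X]setTI.
have := mf measurableT `[a, +oo[%classic (measurable_itv _).
by congr (measurable (_ `&` _)); apply/seteqP; split => w /=; rewrite in_itv/= andbT.
Qed.

Lemma measurable_sublevel (f : T -> R) (a : R) : measurable_fun setT f ->
  measurable [set w | f w <= a].
Proof.
move=> mf; rewrite (_ : [set w | f w <= a] = [set w | - a <= - f w]).
  by apply: measurable_superlevel; exact: measurableT_comp.
by apply/seteqP; split => w /=; rewrite lerN2.
Qed.

Lemma exponential_markov (f : T -> R) (M a : R) : measurable_fun setT f ->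
  (\int[P]_w (expR (f w))%:E <= (expR M)%:E)%E ->
  (P [set w | a <= f w]%R <= (expR (M - a))%:E)%E.
Proof.
move=> mf fM.
have mA := measurable_superlevel a mf.
rewrite expRD mulrC EFinM.
apply: (@le_trans _ _ ((expR (- a))%:E * \int[P]_w (expR (f w))%:E)%E); last first.
  by rewrite lee_pmul2l ?lte_fin ?expR_gt0.
rewrite -ge0_integralZl//; last first.
  by apply/measurable_EFinP; exact: measurableT_comp.
rewrite -[X in P X]setIT -integral_indic//.
apply: ge0_le_integral => //.
- apply/measurable_EFinP; exact: measurable_indic.
- apply/measurable_EFinP; apply: measurable_funM => //; exact: measurableT_comp.
- move=> w _; rewrite -EFinM lee_fin -expRD indicE.
  have [|] := boolP (w \in _); last by rewrite expR_ge0.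
  by rewrite inE /= => aw; rewrite -[leLHS]expR0 ler_expR addrC subr_ge0.
Qed.

End exponential_markov.

(** Weights of total mass below 1 are completed by a mass at 0, where the exponential equals 1. All
    points are then compared with the tangent of [expR] at the mean [M]. *)
Lemma expR_jensen {R : realType} (A : finType) (p x : A -> R) :
  (forall a, 0 <= p a) -> \sum_a p a <= 1 ->
  expR (\sum_a p a * x a) <= \sum_a p a * expR (x a) + (1 - \sum_a p a).
Proof.
move=> p0 p1; set M := \sum_a p a * x a.
have tangent z : expR M * (1 + z - M) <= expR z.
  have -> : expR z = expR M * expR (z - M) by rewrite -expRD addrC subrK.
  by rewrite ler_wpM2l ?expR_ge0// -addrA expR_ge1Dx.
have h1 : \sum_a p a * (expR M * (1 + x a - M)) <= \sum_a p a * expR (x a).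
  by apply: ler_sum => a _; rewrite ler_wpM2l.
have h2 : (1 - \sum_a p a) * (expR M * (1 + 0 - M)) <= (1 - \sum_a p a).
  by rewrite -[leRHS]mulr1 ler_wpM2l ?subr_ge0// -[leRHS]expR0 tangent.
have E : \sum_a p a * (expR M * (1 + x a - M)) =
    expR M * ((\sum_a p a) * (1 - M)) + expR M * M.
  rewrite /M mulr_suml !mulr_sumr -big_split; apply: eq_bigr => a _ /=; ring.
rewrite E in h1.
apply: le_trans (lerD h1 h2); rewrite le_eqVlt; apply/orP; left; apply/eqP; ring.
Qed.

(** * Sums of squares of independent rows *)

Section gaussian_rows.
Context {R : realType} {d : measure_display} {T : measurableType d}
  {P : probability T R} {I : choiceType} (Y : I -> {RV P >-> R}).
Variables (m sg : I -> R).
Hypothesis sg0 : forall i, sg i != 0.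
Hypothesis YN : forall i A, measurable A ->
  distribution P (Y i) A = normal_prob (m i) (sg i) A.
Hypothesis Yind : indep_RVs P Y.
Let Z i w := Y i w - m i.

(** Distinct rows share no coordinate. While one row is integrated out, the squares of the remaining
    rows sit in [psi] and their coordinates join the conditioning list. *)
Lemma gaussian_rows_mgf s (rs : seq (seq I)) (th : R) (b : I -> T -> R) (psi : T -> R) :
  uniq (flatten rs ++ s) ->
  (forall i, measurable_fun setT (b i : generated Y s -> R)) ->
  measurable_fun setT (psi : generated Y s -> R) -> (forall w, 0 <= psi w) ->
  (forall w r, r \in rs -> 2 * th * \sum_(i <- r) b i w ^+ 2 * sg i ^+ 2 < 1) ->
  (\int[P]_w (psi w * expR (th * \sum_(r <- rs) (\sum_(i <- r) b i w * Z i w) ^+ 2))%:E =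
   \int[P]_w (psi w * expR (\sum_(r <- rs)
      - ln (1 - 2 * th * \sum_(i <- r) b i w ^+ 2 * sg i ^+ 2) / 2))%:E)%E.
Proof.
elim: rs psi => [|r rs IH] psi u mb mpsi psi0 lt1.
  by apply: eq_integral => w _; rewrite !big_nil mulr0.
have sub : {subset s <= flatten rs ++ s} by move=> j; rewrite mem_cat orbC => ->.
have lt1r w : 2 * th * \sum_(i <- r) b i w ^+ 2 * sg i ^+ 2 < 1.
  by apply: lt1; rewrite mem_head.
pose g w := - ln (1 - 2 * th * \sum_(i <- r) b i w ^+ 2 * sg i ^+ 2) / 2.
have mg : measurable_fun setT (g : generated Y s -> R).
  apply: measurable_funM => //; apply: measurableT_comp => //; apply: measurableT_comp => //.
  apply: measurable_funB => //; apply: measurable_funM => //.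
  by apply: measurable_sum => i; apply: measurable_funM => //; exact: measurable_funX.
pose psi' w := psi w * expR (th * \sum_(r <- rs) (\sum_(i <- r) b i w * Z i w) ^+ 2).
transitivity (\int[P]_w (psi' w * expR (th * (\sum_(i <- r) b i w * Z i w) ^+ 2))%:E)%E.
  apply: eq_integral => w _; rewrite big_cons -mulrA -expRD; congr (_ * expR _)%:E.
  by rewrite mulrDr addrC.
rewrite (@gaussian_quadratic_mgf _ _ _ P _ Y m sg sg0 YN Yind (flatten rs ++ s) r (fun=> th) b psi').
- transitivity (\int[P]_w ((psi w * expR (g w)) *
      expR (th * \sum_(r <- rs) (\sum_(i <- r) b i w * Z i w) ^+ 2))%:E)%E.
    by apply: eq_integral => w _; rewrite /psi' mulrAC.
  rewrite (IH (fun w => psi w * expR (g w))).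
  + by apply: eq_integral => w _; rewrite big_cons expRD mulrA.
  + by move: u; rewrite /= -catA cat_uniq => /and3P[].
  + by [].
  + by apply: measurable_funM => //; exact: measurableT_comp.
  + by move=> w; rewrite mulr_ge0// expR_ge0.
  + by move=> w r' r'rs; apply: lt1; rewrite inE r'rs orbT.
- by move: u; rewrite /= -catA.
- exact: measurable_cst.
- by move=> i; exact: measurable_generated_sub (mb i).
- apply: measurable_funM; first exact: measurable_generated_sub mpsi.
  apply: measurableT_comp => //; apply: measurable_funM => //.
  apply: measurable_sum_seq => r' r'rs; apply: measurable_funX.
  apply: measurable_sum_seq => i ir'; apply: measurable_funM.
    exact: measurable_generated_sub (mb i).
  apply: measurable_funB => //; apply: measurable_coordinate.
  by rewrite mem_cat; apply/orP; left; apply/flattenP; exists r'.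
- by move=> w; rewrite mulr_ge0// expR_ge0.
- exact: lt1r.
Qed.

(** Multiplying the variance hypothesis by [th] lets one statement serve both tails: it bounds the
    variance from above for positive [th] and from below for negative [th]. *)
Lemma gaussian_rows_mgf_le s (rs : seq (seq I)) (th v : R) (b : I -> T -> R) :
  uniq (flatten rs ++ s) ->
  (forall i, measurable_fun setT (b i : generated Y s -> R)) ->
  (forall w r, r \in rs -> th * \sum_(i <- r) b i w ^+ 2 * sg i ^+ 2 <= th * v) ->
  2 * th * v < 1 ->
  (\int[P]_w (expR (th * \sum_(r <- rs) (\sum_(i <- r) b i w * Z i w) ^+ 2))%:E <=
   (expR (- ln (1 - 2 * th * v) / 2 * (size rs)%:R))%:E)%E.
Proof.
move=> u mb le lt1.
under eq_integral do rewrite -[expR _]mul1r.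
have lt1' w r : r \in rs -> 2 * th * \sum_(i <- r) b i w ^+ 2 * sg i ^+ 2 < 1.
  move=> rrs; apply: le_lt_trans lt1; rewrite -!mulrA ler_wpM2l//; exact: le.
rewrite (@gaussian_rows_mgf s rs th b (fun=> 1))//.
rewrite -[leRHS](integral_probability_cst P).
apply: ge0_le_integral => //.
  apply/measurable_EFinP; apply: measurable_funM => //; apply: measurableT_comp => //.
  apply: measurable_sum => r; apply: measurable_funM => //; apply: measurableT_comp => //.
  apply: measurableT_comp => //; apply: measurable_funB => //; apply: measurable_funM => //.
  apply: measurable_sum => i; apply: measurable_funM => //; apply: measurable_funX.
  exact: measurable_generated (mb i).
move=> w _; rewrite lee_fin mul1r ler_expR.
have -> : - ln (1 - 2 * th * v) / 2 * (size rs)%:R = \sum_(r <- rs) (- ln (1 - 2 * th * v) / 2).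
  by rewrite big_const_seq count_predT iter_addr_0 mulr_natr.
rewrite big_seq [leRHS]big_seq; apply: ler_sum => r rrs.
rewrite ler_pM2r ?invr_gt0// lerN2 ler_ln ?posrE ?subr_gt0//; last exact: lt1'.
by rewrite lerD2l lerN2 -!mulrA ler_wpM2l//; exact: le.
Qed.

(** The Chernoff exponent of a chi-square variable with [k] degrees of freedom at level [y], for the
    optimal tilt [(1 - k / y) / 2]. Writing [y / k] as the square of [1 + x] and using
    [ln (1 + x) <= x], it is at most [- k * x ^+ 2 / 2], which is [- L]. *)
Lemma chi_square_chernoff_exponent (k L y : R) : 0 < k -> 0 < L ->
  y = (Num.sqrt k + Num.sqrt (2 * L)) ^+ 2 ->
  ln (y / k) / 2 * k - (1 - k / y) / 2 * y <= - L.
Proof.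
move=> k0 L0 ydef.
have sk0 : 0 < Num.sqrt k by rewrite sqrtr_gt0.
have sL0 : 0 <= Num.sqrt (2 * L) by rewrite sqrtr_ge0.
have skk : Num.sqrt k ^+ 2 = k by rewrite sqr_sqrtr// ltW.
have sLL : Num.sqrt (2 * L) ^+ 2 = 2 * L by rewrite sqr_sqrtr// mulr_ge0// ltW.
pose x := Num.sqrt (2 * L) / Num.sqrt k.
have x0 : 0 <= x by rewrite divr_ge0// ltW.
have y0 : 0 < y by rewrite ydef exprn_gt0// ltr_wpDr.
have yE : y / k = (1 + x) ^+ 2.
  by rewrite ydef -[X in _ / X]skk -expr_div_n mulrDl divff ?gt_eqF.
have x1 : 0 < 1 + x by rewrite ltr_wpDr.
have lnx : ln (1 + x) <= x by rewrite -[leRHS]expRK ler_ln ?posrE ?expR_gt0// expR_ge1Dx.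
have kx2 : k * x ^+ 2 = 2 * L.
  by rewrite /x expr_div_n skk sLL mulrCA divff ?mulr1// gt_eqF.
rewrite yE lnXn// mulr2n.
have -> : (1 - k / y) / 2 * y = (y - k) / 2 by field; rewrite gt_eqF.
have -> : y = k * (1 + x) ^+ 2 by rewrite -yE mulrCA divff ?mulr1// gt_eqF.
have := ler_wpM2l (ltW k0) lnx; nra.
Qed.

(* Jensen's inequality over the index a reduces the sum over a of the quadratic
   forms, weighted by p a, to a single chi-square variable. *)
Lemma gaussian_quadratic_tail (A : finType) s (rs : seq (seq I)) (p : A -> R) (v L : R)
    (b : A -> I -> T -> R) :
  uniq (flatten rs ++ s) -> (0 < size rs)%N -> 0 < v -> 0 < L ->
  (forall a, 0 <= p a) -> \sum_a p a <= 1 ->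
  (forall a i, measurable_fun setT (b a i : generated Y s -> R)) ->
  (forall a w r, r \in rs -> \sum_(i <- r) b a i w ^+ 2 * sg i ^+ 2 <= p a * v) ->
  (P [set w | (v * (Num.sqrt (size rs)%:R + Num.sqrt (2 * L)) ^+ 2 <=
      \sum_a \sum_(r <- rs) (\sum_(i <- r) b a i w * Z i w) ^+ 2)%R] <= (expR (- L))%:E)%E.
Proof.
move=> u rs0 v0 L0 p0 p1 mb bp.
set k := (size rs)%:R; set y := (_ + _) ^+ 2.
have k0 : 0 < k by rewrite ltr0n.
have ky : k < y.
  rewrite /y -[ltLHS](@sqr_sqrtr _ k) ?ltW// ltrXn2r ?nnegrE ?addr_ge0 ?sqrtr_ge0//.
  by rewrite ltrDl sqrtr_gt0 mulr_gt0.
have y0 : 0 < y by exact: lt_trans ky.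
have ky1 : k / y < 1 by rewrite ltr_pdivrMr// mul1r.
(* The optimal tilt for [v] times a chi-square variable with [k] degrees of freedom. *)
pose th := (1 - k / y) / 2 / v.
have th0 : 0 < th by rewrite !divr_gt0// subr_gt0.
have thv : 2 * th * v = 1 - k / y by rewrite /th; field; rewrite !gt_eqF.
pose Q a w := \sum_(r <- rs) (\sum_(i <- r) b a i w * Z i w) ^+ 2.
have mQ a : measurable_fun setT (Q a).
  apply: measurable_sum => r; apply: measurable_funX; apply: measurable_sum => i.
  apply: measurable_funM; first exact: measurable_generated (mb a i).
  exact: measurable_funB.
(* A vanishing weight forces all coefficients of that form to vanish, so the division by [p a]
   below, which then yields 0, is harmless. *)
have Q0 a w : p a = 0 -> Q a w = 0.
  move=> pa0; rewrite /Q big_seq big1// => r rrs.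
  have S0 : \sum_(i <- r) b a i w ^+ 2 * sg i ^+ 2 = 0.
    apply/eqP; rewrite eq_le; apply/andP; split.
      by have := bp a w r rrs; rewrite pa0 mul0r.
    by apply: sumr_ge0 => i _; rewrite mulr_ge0 ?sqr_ge0.
  rewrite big_seq big1 ?expr0n// => i ir.
  have : b a i w ^+ 2 * sg i ^+ 2 == 0.
    move/eqP: S0; rewrite psumr_eq0 => [/allP /(_ i ir)//|j _].
    by rewrite mulr_ge0 ?sqr_ge0.
  by rewrite mulf_eq0 !sqrf_eq0 (negbTE (sg0 i)) orbF => /eqP ->; rewrite mul0r.
pose M := - ln (k / y) / 2 * k.
have Mth : M = - ln (1 - 2 * th * v) / 2 * k by rewrite thv opprB addrC subrK.
have M0 : 0 <= M.
  have lnky : ln (k / y) <= 0 by apply: ln_le0; exact: ltW.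
  by rewrite /M !mulr_ge0 ?oppr_ge0// ltW.
apply: (@le_trans _ _ (expR (M - th * (v * y)))%:E).
  rewrite [X in P X](_ : _ = [set w | (th * (v * y) <= th * \sum_a Q a w)%R]); last first.
    by apply/seteqP; split => w /=; rewrite ler_pM2l.
  apply: exponential_markov.
    by apply: measurable_funM => //; exact: measurable_sum.
  pose F a w := expR (th / p a * Q a w).
  have mF a : measurable_fun setT (F a).
    by apply: measurableT_comp => //; exact: measurable_funM.
  have c0 : 0 <= 1 - \sum_a p a by rewrite subr_ge0.
  apply: (@le_trans _ _ (\int[P]_w (\sum_a (p a * F a w)%:E + (1 - \sum_a p a)%:E))%E).
    apply: ge0_le_integral => //.
    - by apply/measurable_EFinP; apply: measurableT_comp => //;
        apply: measurable_funM => //; exact: measurable_sum.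
    - apply: emeasurable_funD => //; apply: emeasurable_sum => a.
      by apply/measurable_EFinP; exact: measurable_funM.
    move=> w _; rewrite sumEFin -EFinD lee_fin.
    have -> : th * \sum_a Q a w = \sum_a p a * (th / p a * Q a w).
      rewrite mulr_sumr; apply: eq_bigr => a _.
      have [pa0|pa0] := eqVneq (p a) 0; first by rewrite Q0// !mulr0.
      by field.
    exact: expR_jensen.
  rewrite ge0_integralD//; last 2 first.
  - by move=> w _; rewrite sumEFin lee_fin sumr_ge0// => a _; rewrite mulr_ge0// expR_ge0.
  - by apply: emeasurable_sum => a; apply/measurable_EFinP; exact: measurable_funM.
  rewrite integral_probability_cst ge0_integral_sum//; last 2 first.
  - by move=> a; apply/measurable_EFinP; exact: measurable_funM.
  - by move=> a w _; rewrite lee_fin mulr_ge0// expR_ge0.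
  apply: (@le_trans _ _ (\sum_a (p a * expR M)%:E + (1 - \sum_a p a)%:E)%E).
    rewrite leeD2r//; apply: lee_sum => a _.
    under eq_integral do rewrite EFinM.
    rewrite ge0_integralZl//; [|exact/measurable_EFinP
      |by move=> w _; rewrite lee_fin expR_ge0|by rewrite lee_fin].
    rewrite EFinM lee_wpmul2l ?lee_fin//.
    have [pa0|pa0] := eqVneq (p a) 0.
      under eq_integral do rewrite /F Q0// mulr0 expR0.
      by rewrite integral_probability_cst lee_fin -[leLHS]expR0 ler_expR.
    have pa1 : 0 < p a by rewrite lt_def pa0 p0.
    have thp : 2 * (th / p a) * (p a * v) = 2 * th * v by field.
    have := @gaussian_rows_mgf_le s rs (th / p a) (p a * v) (b a) u (mb a).
    rewrite thp -Mth; apply.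
      move=> w r rrs; apply: ler_wpM2l; last exact: bp.
      by rewrite divr_ge0// ltW.
    by rewrite thv gtrBl divr_gt0.
  rewrite sumEFin -EFinD lee_fin -mulr_suml.
  have e1 : 1 <= expR M by rewrite -[leLHS]expR0 ler_expR.
  by have := ler_wpM2l c0 e1; lra.
rewrite lee_fin ler_expR.
have := chi_square_chernoff_exponent k0 L0 (erefl y).
rewrite /M -lnV ?posrE ?divr_gt0// invf_div.
have -> // : th * (v * y) = (1 - k / y) / 2 * y.
by rewrite /th; field; rewrite !gt_eqF.
Qed.

End gaussian_rows.

(** * Lattice approximation of the unit ball *)

Section lattice.
Context {R : realType}.

(* A lattice point is encoded by signs and absolute values; 0 has two codes per
   coordinate, which only weakens the count below. *)
Definition lattice_point {n B : nat} (k : {ffun 'I_n -> bool * 'I_B}) : 'cV[R]_n :=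
  \col_i ((-1) ^+ (k i).1 * ((k i).2 : nat)%:R).

(** Give each code the weight [y] to the power of its l^1 length. The total weight factors into
    geometric series, with a 2 for the sign, while each counted code weighs at least [y ^+ (q * n)].
    The best [y] is q / (q + 1), used later as 5/6 and 2/3. *)
Lemma lattice_count (n B q : nat) (y : R) : 0 < y -> y < 1 ->
  #|[set k : {ffun 'I_n -> bool * 'I_B} | (\sum_i (k i).2 <= q * n)%N]%SET|%:R
    <= ((y ^- q * (2 / (1 - y))) ^+ n).
Proof.
move=> y0 y1; set S := [set _ | _]%SET.
have y1' : 0 < 1 - y by rewrite subr_gt0.
have geo : \sum_(m < B) y ^+ m <= 1 / (1 - y).
  rewrite ler_pdivlMr// mulrC -[1 - y]opprB mulNr -subrX1 opprB.
  by rewrite gerBl exprn_ge0// ltW.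
have tot : \sum_(k : {ffun 'I_n -> bool * 'I_B}) y ^+ (\sum_i (k i).2) =
    (\sum_(c : bool * 'I_B) y ^+ c.2) ^+ n.
  rewrite -[in RHS](card_ord n) -prodr_const bigA_distr_bigA/=.
  by apply: eq_bigr => k _; rewrite expr_sum.
have one : \sum_(c : bool * 'I_B) y ^+ c.2 <= 2 / (1 - y).
  rewrite -(pair_bigA _ (fun (b : bool) (m : 'I_B) => y ^+ m))/= big_bool/=.
  by move: geo; rewrite div1r; lra.
have low : #|S|%:R * y ^+ (q * n) <= \sum_(k in S) y ^+ (\sum_i (k i).2).
  rewrite mulr_natl -sumr_const; apply: ler_sum => k; rewrite inE => kS.
  by rewrite ler_wiXn2l// ltW.
have up : \sum_(k in S) y ^+ (\sum_i (k i).2) <= (2 / (1 - y)) ^+ n.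
  apply: (@le_trans _ _ (\sum_(k : {ffun 'I_n -> bool * 'I_B}) y ^+ (\sum_i (k i).2))).
    rewrite [leRHS](bigID (mem S))/= lerDl sumr_ge0// => k _.
    by rewrite exprn_ge0// ltW.
  rewrite tot lerXn2r ?nnegrE//.
    by rewrite sumr_ge0// => c _; rewrite exprn_ge0// ltW.
  by rewrite divr_ge0// ltW.
rewrite exprMn exprVn -exprM mulrC ler_pdivlMr ?exprn_gt0//.
exact: le_trans up.
Qed.

(** Rounding [y / h] up with probability [p], its fractional part, and down otherwise gives an error
    of mean zero and variance at most [h ^+ 2 / 4]. The linear term averages out, so one of the two
    neighbours is no worse than the average. *)
Lemma round_coordinate (f : R -> R) (a b c g y h : R) : 0 < h -> c <= g -> 0 <= g ->
  (forall s, f s = a + s * b + s ^+ 2 * c) ->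
  exists2 z : int, `|z%:~R| <= `|y| / h + 1 & f (h * z%:~R - y) <= a + h ^+ 2 / 4 * g.
Proof.
move=> h0 cg g0 fE.
pose z := Num.floor (y / h).
have /andP[z1 z2] : z%:~R <= y / h < (z + 1)%:~R.
  by rewrite ge_floor lt_succ_floor.
have hy : y = h * (y / h) by field; rewrite gt_eqF.
pose p := y / h - z%:~R.
have p0 : 0 <= p by rewrite subr_ge0.
have p1 : p < 1 by rewrite ltrBlDl; move: z2; rewrite intrD.
have ylo : - `|y| / h <= y / h by rewrite ler_pM2r ?invr_gt0// lerNl -normrN ler_norm.
have yhi : y / h <= `|y| / h by rewrite ler_pM2r ?invr_gt0// ler_norm.
have s1 : h * z%:~R - y = - (h * p) by rewrite /p {1}hy; ring.
have s2 : h * (z + 1)%:~R - y = h * (1 - p) by rewrite /p {1}hy intrD; ring.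
have avg : (1 - p) * f (- (h * p)) + p * f (h * (1 - p)) = a + h ^+ 2 * (p * (1 - p)) * c.
  by rewrite !fE; ring.
have pp : p * (1 - p) <= 4^-1.
  by have := sqr_ge0 (p - 2^-1); rewrite expr2 => ?; lra.
have pp0 : 0 <= p * (1 - p) by rewrite mulr_ge0// subr_ge0 ltW.
have bnd : h ^+ 2 * (p * (1 - p)) * c <= h ^+ 2 / 4 * g.
  rewrite -[leLHS]mulrA -[leRHS]mulrA; apply: ler_wpM2l; first exact: sqr_ge0.
  exact: le_trans (ler_wpM2l pp0 cg) (ler_wpM2r g0 pp).
have [le1|lt1] := leP (f (- (h * p))) (a + h ^+ 2 / 4 * g).
  exists z; last by rewrite s1.
  by rewrite ler_norml; apply/andP; split; move: z1 z2; rewrite intrD; lra.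
exists (z + 1); last first.
  rewrite s2 leNgt; apply/negP => lt2.
  have : (1 - p) * (a + h ^+ 2 / 4 * g) < (1 - p) * f (- (h * p)) by rewrite ltr_pM2l// subr_gt0.
  have : p * (a + h ^+ 2 / 4 * g) <= p * f (h * (1 - p)) by rewrite ler_wpM2l// ltW.
  by move: avg bnd; lra.
by rewrite ler_norml; apply/andP; split; move: z1 z2; rewrite intrD; lra.
Qed.

(** The second-order coefficient [c i] is the same at every point, so coordinates can be rounded in
    turn and the losses add up. A coordinate not yet treated still equals that of [v], which keeps
    the size bound in terms of [v]. *)
Lemma lattice_rounding (n B : nat) (f : 'cV[R]_n -> R) (b : 'I_n -> 'cV[R]_n -> R)
    (c g : 'I_n -> R) (h : R) (v : 'cV[R]_n) : 0 < h ->
  (forall i x s, f (x + s *: delta_mx i 0) = f x + s * b i x + s ^+ 2 * c i) ->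
  (forall i, c i <= g i) -> (forall i, 0 <= g i) ->
  (forall i, `|v i 0| / h + 1 < B%:R) ->
  exists2 k : {ffun 'I_n -> bool * 'I_B},
    (forall i, ((k i).2 : nat)%:R <= `|v i 0| / h + 1) &
    f (h *: lattice_point k) <= f v + h ^+ 2 / 4 * \sum_i g i.
Proof.
move=> h0 fE cg g0 vB.
suff [x xv fx] : exists2 x : 'cV[R]_n,
    (forall i, exists2 z : int, x i 0 = h * z%:~R & `|z%:~R| <= `|v i 0| / h + 1) &
    f x <= f v + h ^+ 2 / 4 * \sum_i g i.
  have /fin_all_exists [z zP] : forall i, exists z : int,
      x i 0 = h * z%:~R /\ `|z%:~R| <= `|v i 0| / h + 1.
    by move=> i; have [z] := xv i; exists z.
  have zB i : (`|z i| < B)%N.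
    rewrite -(ltr_nat R) natr_absz intr_norm.
    exact: le_lt_trans (zP i).2 (vB i).
  exists [ffun i => ((z i < 0), Ordinal (zB i))].
    by move=> i; rewrite ffunE/= natr_absz intr_norm; exact: (zP i).2.
  suff -> : h *: lattice_point [ffun i => ((z i < 0), Ordinal (zB i))] = x by [].
  apply/matrixP => i j; rewrite !mxE ord1 (zP i).1 ffunE/=; congr (_ * _).
  by rewrite natr_absz -[in RHS](mulz_sign_abs (z i)) intrM rmorph_sign.
suff H : forall r : seq 'I_n, uniq r -> exists2 x : 'cV[R]_n,
    (forall i, if i \in r then exists2 z : int, x i 0 = h * z%:~R & `|z%:~R| <= `|v i 0| / h + 1
               else x i 0 = v i 0) &
    f x <= f v + h ^+ 2 / 4 * \sum_(i <- r) g i.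
  have [x xP fx] := H _ (index_enum_uniq 'I_n); exists x => // i.
  by have := xP i; rewrite mem_index_enum.
elim=> [_|i r IH /=]; first by exists v => //; rewrite big_nil mulr0 addr0.
move=> /andP[ir /IH[x xP fx]].
have xi : x i 0 = v i 0 by have := xP i; rewrite (negbTE ir).
have [z zb fz] := round_coordinate (v i 0) h0 (cg i) (g0 i) (fE i x).
exists (x + (h * z%:~R - v i 0) *: delta_mx i 0).
  move=> j; rewrite inE !mxE; case: eqP => [->|/eqP ji]/=.
    by exists z => //; rewrite xi mulr1 addrC subrK.
  by rewrite mulr0 addr0; exact: xP.
by apply: le_trans fz _; move: fx; rewrite big_cons mulrDr; lra.
Qed.

End lattice.

(** * Dot products, Rayleigh quotients and least squares *)

Section dot_product.
Context {R : realType}.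

Definition dot {q : nat} (u v : 'cV[R]_q) : R := \sum_k u k 0 * v k 0.

Section basics.
Context {q : nat}.
Implicit Types u v w : 'cV[R]_q.

Lemma dotC u v : dot u v = dot v u.
Proof. by apply: eq_bigr => k _; rewrite mulrC. Qed.

Lemma dotDr u v w : dot u (v + w) = dot u v + dot u w.
Proof. by rewrite -big_split; apply: eq_bigr => k _; rewrite mxE mulrDr. Qed.

Lemma dotDl u v w : dot (v + w) u = dot v u + dot w u.
Proof. by rewrite dotC dotDr dotC [dot u w]dotC. Qed.

Lemma dotZr u v a : dot u (a *: v) = a * dot u v.
Proof. by rewrite mulr_sumr; apply: eq_bigr => k _; rewrite mxE mulrCA. Qed.

Lemma dotZl u v a : dot (a *: v) u = a * dot v u.
Proof. by rewrite dotC dotZr dotC. Qed.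

Lemma dotNr u v : dot u (- v) = - dot u v.
Proof. by rewrite -scaleN1r dotZr mulN1r. Qed.

Lemma dotNl u v : dot (- v) u = - dot v u.
Proof. by rewrite dotC dotNr dotC. Qed.

Lemma dot_sumr I (r : seq I) (P : pred I) u (F : I -> 'cV[R]_q) :
  dot u (\sum_(i <- r | P i) F i) = \sum_(i <- r | P i) dot u (F i).
Proof.
elim/big_rec2 : _ => [|i x y _ <-]; last by rewrite dotDr.
by apply: big1 => k _; rewrite mxE mulr0.
Qed.

Lemma dot_ge0 v : 0 <= dot v v.
Proof. by apply: sumr_ge0 => k _; rewrite -expr2 sqr_ge0. Qed.

Lemma dot0r v : dot v 0 = 0.
Proof. by apply: big1 => k _; rewrite mxE mulr0. Qed.

Lemma dot_eq0 v : dot v v = 0 -> v = 0.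
Proof.
move=> /eqP; rewrite psumr_eq0 => [|k _]; last by rewrite -expr2 sqr_ge0.
move=> /allP vk; apply/matrixP => k j; rewrite ord1 mxE; apply/eqP.
by have := vk k (mem_index_enum k); rewrite /= mulf_eq0 orbb.
Qed.

Lemma dot_delta v k : dot v (delta_mx k 0) = v k 0.
Proof.
rewrite /dot (bigD1 k)//= mxE !eqxx mulr1 big1 ?addr0// => j /negbTE jk.
by rewrite mxE jk mulr0.
Qed.

Lemma vnormE v : vnorm v = Num.sqrt (dot v v).
Proof. by congr Num.sqrt; apply: eq_bigr => k _; rewrite expr2. Qed.

Lemma vnorm_sqr v : vnorm v ^+ 2 = dot v v.
Proof. by rewrite vnormE sqr_sqrtr// dot_ge0. Qed.

Lemma dot_gt0 v : v != 0 -> 0 < dot v v.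
Proof.
by move=> v0; rewrite lt_def dot_ge0 andbT; apply: contra v0 => /eqP /dot_eq0 ->.
Qed.

Lemma vnorm_gt0 v : v != 0 -> 0 < vnorm v.
Proof. by move=> v0; rewrite vnormE sqrtr_gt0 dot_gt0. Qed.

Lemma dot_normalize v : v != 0 -> dot ((vnorm v)^-1 *: v) ((vnorm v)^-1 *: v) = 1.
Proof.
by move=> v0; rewrite dotZl dotZr -vnorm_sqr mulrA -expr2 -exprMn mulVf ?expr1n// gt_eqF// vnorm_gt0.
Qed.

Lemma semi_cauchy_schwarz (B : 'cV[R]_q -> 'cV[R]_q -> R) :
  (forall u v, B u v = B v u) -> (forall u v w, B u (v + w) = B u v + B u w) ->
  (forall u v a, B u (a *: v) = a * B u v) -> (forall v, 0 <= B v v) ->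
  forall u v, B u v ^+ 2 <= B u u * B v v.
Proof.
move=> BC BD BZ B0 u v.
have BZl x y a : B (a *: x) y = a * B x y by rewrite BC BZ BC.
have BDl x y z : B (y + z) x = B y x + B z x by rewrite BC BD ![B x _]BC.
have key s : 0 <= B u u + 2 * s * B u v + s ^+ 2 * B v v.
  have := B0 (u + s *: v); rewrite !BDl !BD !BZl !BZ [B v u]BC.
  by congr (0 <= _); ring.
have [v0|v0] := eqVneq (B v v) 0.
  suff -> : B u v = 0 by rewrite expr0n v0 mulr0.
  apply/eqP; apply: contraT => uv0.
  (* With [B v v = 0] the expression in [key] is affine in [s]; this choice of [s] makes it -1
     unless [B u v] vanishes. *)
  have := key (- (B u u + 1) / (2 * B u v)); rewrite v0 mulr0 addr0.
  have -> : 2 * (- (B u u + 1) / (2 * B u v)) * B u v = - (B u u + 1) by field.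
  by lra.
have vp : 0 < B v v by rewrite lt_def v0 B0.
have := key (- B u v / B v v).
have -> : B u u + 2 * (- B u v / B v v) * B u v + (- B u v / B v v) ^+ 2 * B v v =
  (B u u * B v v - B u v ^+ 2) / B v v by field.
by rewrite pmulr_lge0 ?invr_gt0// subr_ge0.
Qed.

Lemma cauchy_schwarz u v : dot u v ^+ 2 <= dot u u * dot v v.
Proof.
by apply: semi_cauchy_schwarz u v; [exact: dotC|exact: dotDr|exact: dotZr|exact: dot_ge0].
Qed.

End basics.

Lemma dot_mulmx {p q} (A : 'M[R]_(p, q)) u v : dot u (A *m v) = dot (A^T *m u) v.
Proof.
rewrite /dot; under eq_bigr do rewrite mxE mulr_sumr.
rewrite exchange_big; apply: eq_bigr => k _; rewrite mxE mulr_suml.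
by apply: eq_bigr => j _; rewrite mxE mulrCA mulrA.
Qed.

Lemma mulmx_outer {p q} (u : 'cV[R]_p) (w v : 'cV[R]_q) : u *m w^T *m v = dot w v *: u.
Proof.
rewrite -mulmxA; apply/matrixP => i j; rewrite !mxE big_ord1 !mxE (ord1 j) mulrC; congr (_ * _).
by apply: eq_bigr => k _; rewrite mxE.
Qed.

Lemma frobenius_bound {p q} (A : 'M[R]_(p, q)) v :
  dot (A *m v) (A *m v) <= (\sum_i \sum_j A i j ^+ 2) * dot v v.
Proof.
rewrite mulr_suml; apply: ler_sum => i _; rewrite -expr2.
have := cauchy_schwarz (row i A)^T v.
congr (_ ^+ 2 <= _ * _).
  by rewrite mxE; apply: eq_bigr => j _; rewrite !mxE.
by apply: eq_bigr => j _; rewrite !mxE expr2.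
Qed.

Lemma mulmx_bounded {p q} (A : 'M[R]_(p, q)) :
  exists2 K : R, 0 < K & forall v, dot (A *m v) (A *m v) <= K * dot v v.
Proof.
exists (1 + \sum_i \sum_j A i j ^+ 2).
  by rewrite ltr_wpDr// sumr_ge0// => i _; rewrite sumr_ge0// => j _; rewrite sqr_ge0.
move=> v; apply: le_trans (frobenius_bound A v) _.
by rewrite mulrDl mul1r lerDr dot_ge0.
Qed.

(** The test vectors are [v] and [A *m v], both normalized. Passing back from the unit sphere to the
    unit ball uses [0 <= c]. *)
Lemma specnorm_le {p q} (A : 'M[R]_(p, q)) (c : R) : 0 <= c ->
  (forall u v, dot u u = 1 -> dot v v = 1 -> dot u (A *m v) <= c) -> specnorm A <= c.
Proof.
move=> c0 Ac; apply: ge_sup.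
  exists (vnorm (A *m 0)); exists 0 => //=.
  by rewrite vnormE dot0r sqrtr0.
move=> _ [v /= v1 <-].
have [->|Av0] := eqVneq (A *m v) 0; first by rewrite vnormE dot0r sqrtr0.
have v0 : v != 0 by apply: contra Av0 => /eqP ->; rewrite mulmx0.
have := Ac _ _ (dot_normalize Av0) (dot_normalize v0).
rewrite dotZl -scalemxAr dotZr -vnorm_sqr.
have -> : (vnorm (A *m v))^-1 * ((vnorm v)^-1 * vnorm (A *m v) ^+ 2) = vnorm (A *m v) / vnorm v.
  by field; rewrite !gt_eqF ?vnorm_gt0.
rewrite ler_pdivrMr ?vnorm_gt0// => h; apply: le_trans h _.
by rewrite -[leRHS]mulr1 ler_wpM2l.
Qed.

(** * The smallest eigenvalue as the infimum of the Rayleigh quotient *)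

Section rayleigh.
Context {q : nat}.
Variables (A : 'M[R]_q.+1) (m : R).
Hypothesis Asym : A^T = A.
Hypothesis Am : forall v, m * dot v v <= dot v (A *m v).

Lemma eigenvalue_ge a : eigenvalue A a -> m <= a.
Proof.
move=> /eigenvalueP[v vA v0].
have vA' : A *m v^T = a *: v^T by rewrite -{1}Asym -trmx_mul vA linearZ.
have vT0 : v^T != 0 by apply: contra v0 => /eqP h; rewrite -[v]trmxK h trmx0.
by have := Am v^T; rewrite vA' dotZr ler_pM2r// dot_gt0.
Qed.

Let S := [set dot v (A *m v) | v in [set v | dot v v = 1]].
Let rho := inf S.

Let S_neq0 : S !=set0.
Proof.
exists (dot (delta_mx 0 0) (A *m delta_mx 0 0)); exists (delta_mx 0 0) => //=.
by rewrite dot_delta mxE !eqxx.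
Qed.

Let S_lb : lbound S m.
Proof. by move=> _ [v /= v1 <-]; have := Am v; rewrite v1 mulr1. Qed.

Let rho_le v : rho * dot v v <= dot v (A *m v).
Proof.
have [->|v0] := eqVneq v 0; first by rewrite mulmx0 !dot0r mulr0.
have n0 := dot_gt0 v0.
have h : rho <= dot ((vnorm v)^-1 *: v) (A *m ((vnorm v)^-1 *: v)).
  by apply: ge_inf; [exists m; exact: S_lb|exists ((vnorm v)^-1 *: v) => //=; exact: dot_normalize].
move: h; rewrite dotZl -scalemxAr dotZr mulrA -expr2 exprVn vnorm_sqr => h.
by rewrite -ler_pdivlMr// mulrC.
Qed.

(** An argument without compactness. If [D = A - rho] were invertible, Cauchy-Schwarz for the
    semidefinite form of [D] would give |D v|^2 <= (1 + K) <v, D v>, and boundedness of the inverse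
    would keep <v, D v> away from 0 on the sphere, against the choice of [rho]. The eigenvalue set
    is thereby nonempty, so [lambda_min] is a genuine infimum. *)
Let rho_eigenvalue : eigenvalue A rho.
Proof.
apply: contraT => neig.
pose D := A - rho%:M.
have Dunit : D \in unitmx.
  by rewrite -row_free_unit -kermx_eq0; apply: contraT => h; rewrite /eigenvalue/eigenspace h in neig.
have Dsym : D^T = D by rewrite /D linearB/= Asym tr_scalar_mx.
have DE v : dot v (D *m v) = dot v (A *m v) - rho * dot v v.
  by rewrite mulmxBl mul_scalar_mx dotDr dotNr dotZr.
have D0 v : 0 <= dot v (D *m v) by rewrite DE subr_ge0.
have DCS u v : dot u (D *m v) ^+ 2 <= dot u (D *m u) * dot v (D *m v).
  apply: (semi_cauchy_schwarz (B := fun u v => dot u (D *m v))).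
  - by move=> x y; rewrite dot_mulmx Dsym dotC.
  - by move=> x y z; rewrite mulmxDr dotDr.
  - by move=> x y a; rewrite -scalemxAr dotZr.
  - exact: D0.
have [K K0 DK] := mulmx_bounded D.
have [K' K'0 DK'] := mulmx_bounded (invmx D).
have step v : dot (D *m v) (D *m v) <= (1 + K) * dot v (D *m v).
  set w := D *m v; have [->|w0] := eqVneq w 0.
    by rewrite !dot0r mulr0.
  have ww := dot_gt0 w0.
  have h1 : dot w (D *m w) <= (1 + K) * dot w w.
    have := dot_ge0 (w - D *m w); have := DK w; have := dot_ge0 (D *m w).
    rewrite !(dotDl, dotDr, dotNl, dotNr) [dot (D *m w) w]dotC.
    by have := ww; lra.
  have h2 := DCS w v; rewrite -/w in h2.
  rewrite -(ler_pM2r ww) -expr2; apply: le_trans h2 _.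
  by rewrite mulrC mulrAC; rewrite [leRHS]mulrC; apply: ler_wpM2l => //; exact: D0.
have low v : dot v v = 1 -> (K' * (1 + K))^-1 <= dot v (D *m v).
  move=> v1; have := DK' (D *m v); rewrite mulmxA mulVmx// mul1mx v1 => h.
  have K1 : 0 < 1 + K by rewrite ltr_wpDl// ltW.
  rewrite -[leLHS]mul1r ler_pdivrMr ?mulr_gt0// mulrC -mulrA.
  by apply: le_trans h _; rewrite ler_pM2l.
have : rho + (K' * (1 + K))^-1 <= rho.
  apply: lb_le_inf => // _ [v /= v1 <-].
  by have := low v v1; rewrite DE v1 mulr1 lerBrDl.
have K1 : 0 < 1 + K by rewrite ltr_wpDl// ltW.
by rewrite gerDl leNgt invr_gt0 mulr_gt0.
Qed.

Lemma lambda_min_ge : m <= lambda_min A.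
Proof.
apply: lb_le_inf; first by exists rho; exact: rho_eigenvalue.
by move=> a /=; exact: eigenvalue_ge.
Qed.

Lemma lambda_min_rayleigh v : lambda_min A * dot v v <= dot v (A *m v).
Proof.
apply: le_trans (rho_le v); apply: ler_wpM2r; first exact: dot_ge0.
apply: ge_inf; last exact: rho_eigenvalue.
by exists m => a; exact: eigenvalue_ge.
Qed.

End rayleigh.

(** The inverse meets the Penrose conditions, so [xget] returns a solution of them, and the first
    condition alone forces any solution to be the inverse. *)
Lemma pinv_unit {n} (A : 'M[R]_n) : A \in unitmx -> Defs.pinv A = invmx A.
Proof.
move=> Au; have : penrose A (Defs.pinv A).
  suff : [set B | penrose A B] (Defs.pinv A) by [].
  apply: xgetPex; exists (invmx A); rewrite /penrose /= mulmxV// mulVmx// !mul1mx.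
  by split => //; exact: trmx1.
case=> h _ _ _.
have /(congr1 (mulmx (invmx A))) : A *m Defs.pinv A *m A = A by [].
rewrite mulmxA mulKmx// mulVmx// => h'.
by rewrite -[LHS]mulmx1 -(mulmxV Au) mulmxA h' mul1mx.
Qed.

Lemma positive_unitmx {n} (A : 'M[R]_n) (c : R) : 0 < c -> A^T = A ->
  (forall v, c * dot v v <= dot v (A *m v)) -> A \in unitmx.
Proof.
move=> c0 Asym Ac; rewrite -row_free_unit -kermx_eq0; apply/eqP/row_matrixP => i.
rewrite row0; set r := row i _.
have rA : r *m A = 0 by apply/sub_kermxP; exact: row_sub.
have Ar : A *m r^T = 0 by rewrite -{1}Asym -trmx_mul rA trmx0.
have := Ac r^T; rewrite Ar dot0r => h.
have /dot_eq0 /(congr1 trmx) : dot r^T r^T = 0.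
  by apply/eqP; rewrite eq_le dot_ge0 andbT; move: h; rewrite pmulr_rle0.
by rewrite trmxK trmx0.
Qed.

End dot_product.

(** * From lattice points to all directions *)

Section lattice_bounds.
Context {R : realType}.

Lemma unit_entry_le1 {q} (v : 'cV[R]_q) i : dot v v = 1 -> `|v i 0| <= 1.
Proof.
move=> v1; have : `|v i 0| ^+ 2 <= 1.
  rewrite real_normK ?num_real// -[leRHS]v1 /dot (bigD1 i)//= -expr2 lerDl.
  by apply: sumr_ge0 => j _; rewrite -expr2 sqr_ge0.
by rewrite -[X in _ <= X](expr1n _ 2%N) ler_sqr ?nnegrE.
Qed.

Lemma unit_l1_le {q} (v : 'cV[R]_q) : dot v v = 1 -> \sum_i `|v i 0| <= Num.sqrt q%:R.
Proof.
move=> v1; have := cauchy_schwarz (\col_i `|v i 0|) (\col_(i < q) (1 : R)).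
have -> : dot (\col_i `|v i 0|) (\col_(i < q) (1 : R)) = \sum_i `|v i 0|.
  by apply: eq_bigr => i _; rewrite !mxE mulr1.
have -> : dot (\col_i `|v i 0|) (\col_i `|v i 0|) = 1.
  by rewrite -v1; apply: eq_bigr => i _; rewrite !mxE -normrM -expr2 ger0_norm ?sqr_ge0 ?expr2.
have -> : dot (\col_(i < q) (1 : R)) (\col_(i < q) (1 : R)) = q%:R.
  rewrite -[in RHS](card_ord q) -sum1_card natr_sum; apply: eq_bigr => i _.
  by rewrite !mxE mulr1.
rewrite mul1r => h; rewrite -(@ler_pXn2r _ 2)// ?nnegrE ?sqrtr_ge0//.
  by rewrite sqr_sqrtr.
by apply: sumr_ge0.
Qed.

Lemma dot_lattice_point {q B} (k : {ffun 'I_q -> bool * 'I_B}) :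
  dot (lattice_point k : 'cV[R]_q) (lattice_point k) = \sum_i ((k i).2 : nat)%:R ^+ 2.
Proof.
by apply: eq_bigr => i _; rewrite !mxE -expr2 exprMn -exprM mulnC exprM sqrrN expr1n expr1n mul1r.
Qed.

Lemma lattice_lower_bound (J : finType) (n : nat) (c : J -> 'cV[R]_n) (V : R) :
  (0 < n)%N -> 0 <= V ->
  \sum_j dot (c j) (c j) <= 2 * n%:R * V ->
  (forall k : {ffun 'I_n -> bool * 'I_(4 * n + 2)}, (\sum_i (k i).2 <= 5 * n)%N ->
    3 / 16 * V * dot (lattice_point k) (lattice_point k)
      <= \sum_j dot (c j) (lattice_point k) ^+ 2) ->
  forall v, 5 / 32 * V * dot v v <= \sum_j dot (c j) v ^+ 2.
Proof.
move=> n0 V0 trc low.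
have nR0 : 0 < n%:R :> R by rewrite ltr0n.
have sn0 : 0 < Num.sqrt n%:R :> R by rewrite sqrtr_gt0.
have snn : Num.sqrt n%:R ^+ 2 = n%:R :> R by rewrite sqr_sqrtr// ltW.
suff unit v : dot v v = 1 -> 5 / 32 * V <= \sum_j dot (c j) v ^+ 2.
  move=> v; have [->|v0] := eqVneq v 0.
    by rewrite dot0r mulr0 sumr_ge0// => j _; rewrite sqr_ge0.
  have := unit _ (dot_normalize v0).
  under eq_bigr do rewrite dotZr exprMn exprVn vnorm_sqr.
  by rewrite -mulr_sumr ler_pdivlMl ?dot_gt0// mulrC.
move=> v1.
(* With this mesh the rounded point has l^1 length at most 4 sqrt n * sqrt n + n = 5n, and each
   entry stays below 4n + 2. *)
pose h : R := (4 * Num.sqrt n%:R)^-1.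
have h0 : 0 < h by rewrite invr_gt0 mulr_gt0.
have hV x : x / h = 4 * Num.sqrt n%:R * x by rewrite /h invrK mulrC.
have h2 : h ^+ 2 = (16 * n%:R)^-1 by rewrite /h exprVn exprMn snn; congr (_ * _)^-1; ring.
(* [f] is homogeneous of degree 2 and nonnegative at the admissible lattice points, so [f v] is at
   least minus the rounding loss [V / 32]. *)
pose f x := \sum_j dot (c j) x ^+ 2 - 3 / 16 * V * dot x x.
pose b i x := 2 * (\sum_j dot (c j) x * c j i 0) - 2 * (3 / 16 * V) * x i 0.
pose cc i := \sum_j c j i 0 ^+ 2 - 3 / 16 * V.
pose g i := \sum_j c j i 0 ^+ 2.
have fE i x s : f (x + s *: delta_mx i 0) = f x + s * b i x + s ^+ 2 * cc i.
  rewrite /f /b /cc !(dotDl, dotDr, dotZl, dotZr) !dot_delta dotC dot_delta.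
  have -> : \sum_j dot (c j) (x + s *: delta_mx i 0) ^+ 2 =
      \sum_j dot (c j) x ^+ 2 + 2 * s * (\sum_j dot (c j) x * c j i 0)
      + s ^+ 2 * \sum_j c j i 0 ^+ 2.
    rewrite !mulr_sumr -!big_split; apply: eq_bigr => j _ /=.
    by rewrite dotDr dotZr dot_delta; ring.
  by rewrite mxE !eqxx/=; ring.
have ccg i : cc i <= g i by rewrite gerBl !mulr_ge0.
have g0 i : 0 <= g i by apply: sumr_ge0 => j _; rewrite sqr_ge0.
have snle : Num.sqrt n%:R <= n%:R :> R.
  rewrite -[leRHS]snn expr2 ler_peMr ?(ltW sn0)// -[leLHS]sqrtr1 ler_sqrt// ler1n//.
have vB i : `|v i 0| / h + 1 < (4 * n + 2)%:R.
  rewrite hV natrD natrM; have := unit_entry_le1 i v1 => vi.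
  have : Num.sqrt n%:R * `|v i 0| <= Num.sqrt n%:R * 1 by rewrite ler_wpM2l// ltW.
  by move: snle; lra.
have [k kv fk] := lattice_rounding h0 fE ccg g0 vB.
have ksum : (\sum_i (k i).2 <= 5 * n)%N.
  rewrite -(ler_nat R) natr_sum natrM.
  apply: (@le_trans _ _ (\sum_i (`|v i 0| / h + 1))); first by apply: ler_sum.
  rewrite big_split/= sumr_const card_ord -mulr_suml hV.
  have := ler_wpM2l (ltW sn0) (unit_l1_le v1).
  by rewrite -expr2 snn -(mulr_natr 1 n); lra.
have f0 : 0 <= f (h *: lattice_point k).
  have -> : f (h *: lattice_point k) = h ^+ 2 * (\sum_j dot (c j) (lattice_point k) ^+ 2
      - 3 / 16 * V * dot (lattice_point k) (lattice_point k)).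
    rewrite /f dotZl dotZr; set D := dot _ _.
    have -> : \sum_j dot (c j) (h *: lattice_point k) ^+ 2 =
        h ^+ 2 * \sum_j dot (c j) (lattice_point k) ^+ 2.
      by rewrite mulr_sumr; apply: eq_bigr => j _; rewrite dotZr exprMn.
    clearbody h D. ring.
  by rewrite mulr_ge0 ?sqr_ge0// subr_ge0; exact: low.
have gs : \sum_i g i = \sum_j dot (c j) (c j).
  rewrite exchange_big; apply: eq_bigr => j _; apply: eq_bigr => i _.
  by rewrite expr2.
have : 0 <= f v + h ^+ 2 / 4 * (2 * n%:R * V).
  apply: le_trans f0 (le_trans fk _); rewrite lerD2l gs ler_wpM2l// divr_ge0 ?sqr_ge0//.
rewrite h2 /f v1 mulr1.
have -> : (16 * n%:R)^-1 / 4 * (2 * n%:R * V) = V / 32 by field; rewrite gt_eqF.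
by lra.
Qed.

(** The cross terms are the quadratic form of [C], whose Frobenius norm is at most [V / 16]. They
    occur doubled in the expanded square, and 5/32 - 2/16 = 1/32. *)
Lemma design_lower_bound (J : finType) (n : nat) (c mu : J -> 'cV[R]_n) (V : R) :
  0 <= V ->
  (forall v, 5 / 32 * V * dot v v <= \sum_j dot (c j) v ^+ 2) ->
  \sum_i \sum_k (\sum_j c j i 0 * mu j k 0) ^+ 2 <= (V / 16) ^+ 2 ->
  forall v, V / 32 * dot v v + \sum_j dot (mu j) v ^+ 2
    <= \sum_j dot (mu j + c j) v ^+ 2.
Proof.
move=> V0 low cross v.
pose C := \sum_j c j *m (mu j)^T.
have CE : dot v (C *m v) = \sum_j dot (c j) v * dot (mu j) v.
  rewrite mulmx_suml dot_sumr; apply: eq_bigr => j _.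
  by rewrite mulmx_outer dotZr mulrC dotC.
have crossv : dot v (C *m v) ^+ 2 <= (V / 16 * dot v v) ^+ 2.
  apply: le_trans (cauchy_schwarz _ _) _.
  rewrite exprMn expr2 mulrCA; apply: ler_wpM2l; first exact: dot_ge0.
  apply: le_trans (frobenius_bound _ _) _.
  apply: ler_wpM2r; first exact: dot_ge0.
  rewrite (_ : \sum_i _ = \sum_i \sum_k (\sum_j c j i 0 * mu j k 0) ^+ 2)//.
  apply: eq_bigr => i _; apply: eq_bigr => k _; congr (_ ^+ 2).
  rewrite summxE; apply: eq_bigr => j _; rewrite mxE big_ord1 mxE//.
have Vv0 : 0 <= V / 16 * dot v v by rewrite mulr_ge0 ?dot_ge0 ?divr_ge0.
have : - (V / 16 * dot v v) <= dot v (C *m v).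
  by have := crossv; rewrite -[X in X <= _]real_normK ?num_real// ler_sqr ?nnegrE// ler_norml => /andP[].
have := low v.
have -> : \sum_j dot (mu j + c j) v ^+ 2 = \sum_j dot (c j) v ^+ 2
    + \sum_j dot (mu j) v ^+ 2 + 2 * dot v (C *m v).
  rewrite CE mulr_sumr -!big_split; apply: eq_bigr => j _ /=.
  by rewrite dotDl; ring.
by lra.
Qed.

(** The convex hull property in dual form: rounding against a linear functional costs nothing. The
    mesh 1 / sqrt q gives l^1 length at most q + q and squared length at most q + 2q + q. *)
Lemma linear_rounding (q : nat) (a v : 'cV[R]_q) : (0 < q)%N -> dot v v = 1 ->
  exists k : {ffun 'I_q -> bool * 'I_(q + 2)},
    [/\ (\sum_i (k i).2 <= 2 * q)%N,
        dot (lattice_point k) (lattice_point k) <= 4 * q%:R :> R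
      & dot a v <= (Num.sqrt q%:R)^-1 * dot a (lattice_point k)].
Proof.
move=> q0 v1.
have qR0 : 0 < q%:R :> R by rewrite ltr0n.
have sq0 : 0 < Num.sqrt q%:R :> R by rewrite sqrtr_gt0.
have sqq : Num.sqrt q%:R ^+ 2 = q%:R :> R by rewrite sqr_sqrtr// ltW.
pose h : R := (Num.sqrt q%:R)^-1.
have h0 : 0 < h by rewrite invr_gt0.
have hV x : x / h = Num.sqrt q%:R * x by rewrite /h invrK mulrC.
have fE i x s : - dot a (x + s *: delta_mx i 0) = - dot a x + s * (- a i 0) + s ^+ 2 * 0.
  by rewrite dotDr dotZr dot_delta; ring.
have sqle : Num.sqrt q%:R <= q%:R :> R.
  by rewrite -[leRHS]sqq expr2 ler_peMr ?(ltW sq0)// -[leLHS]sqrtr1 ler_sqrt// ler1n.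
have vB i : `|v i 0| / h + 1 < (q + 2)%:R.
  rewrite hV natrD; have := unit_entry_le1 i v1 => vi.
  have : Num.sqrt q%:R * `|v i 0| <= Num.sqrt q%:R * 1 by rewrite ler_wpM2l// ltW.
  by move: sqle; lra.
have [k kv fk] := lattice_rounding (f := fun x => - dot a x) (c := fun=> 0) (g := fun=> 0)
  h0 fE (fun=> lexx _) (fun=> lexx _) vB.
have l1 := ler_wpM2l (ltW sq0) (unit_l1_le v1); rewrite -expr2 sqq in l1.
exists k; split.
- rewrite -(ler_nat R) natr_sum natrM.
  apply: (@le_trans _ _ (\sum_i (`|v i 0| / h + 1))); first by apply: ler_sum.
  rewrite big_split/= sumr_const card_ord -mulr_suml hV.
  by move: l1; rewrite -(mulr_natr 1 q); lra.
- rewrite dot_lattice_point.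
  apply: (@le_trans _ _ (\sum_i (`|v i 0| / h + 1) ^+ 2)).
    by apply: ler_sum => i _; rewrite ler_sqr ?nnegrE// addr_ge0// divr_ge0// ltW.
  have -> : \sum_i (`|v i 0| / h + 1) ^+ 2 =
      q%:R * \sum_i v i 0 * v i 0 + 2 * (Num.sqrt q%:R * \sum_i `|v i 0|) + \sum_(i < q) 1.
    rewrite !mulr_sumr -!big_split; apply: eq_bigr => i _ /=.
    by rewrite hV sqrrD exprMn sqq real_normK ?num_real// expr2; ring.
  rewrite -/(dot v v) v1 sumr_const card_ord.
  by move: l1; rewrite -(mulr_natr 1 q); lra.
- by move: fk; rewrite big1// mulr0 addr0 lerN2 dotZr.
Qed.

(** [v] is rounded against the functional given by [D^T *m u], then [u] against the image under [D]
    of the lattice point just found. The two meshes account for the square roots. *)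
Lemma lattice_operator_bound (l n : nat) (D : 'M[R]_(l, n)) (tau : R) :
  (0 < l)%N -> (0 < n)%N ->
  (forall (k' : {ffun 'I_l -> bool * 'I_(l + 2)}) (k : {ffun 'I_n -> bool * 'I_(n + 2)}),
    (\sum_i (k' i).2 <= 2 * l)%N -> (\sum_i (k i).2 <= 2 * n)%N ->
    dot (lattice_point k' : 'cV[R]_l) (lattice_point k') <= 4 * l%:R ->
    dot (lattice_point k : 'cV[R]_n) (lattice_point k) <= 4 * n%:R ->
    dot (lattice_point k') (D *m lattice_point k) <= tau * (Num.sqrt l%:R * Num.sqrt n%:R)) ->
  forall u v, dot u u = 1 -> dot v v = 1 -> dot u (D *m v) <= tau.
Proof.
move=> l0 n0 H u v u1 v1.
have sl0 : 0 < Num.sqrt l%:R :> R by rewrite sqrtr_gt0 ltr0n.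
have sn0 : 0 < Num.sqrt n%:R :> R by rewrite sqrtr_gt0 ltr0n.
have [k [k1 k2 k3]] := linear_rounding (D^T *m u) n0 v1.
have [k' [k1' k2' k3']] := linear_rounding (D *m lattice_point k) l0 u1.
rewrite dot_mulmx; apply: le_trans k3 _; rewrite -dot_mulmx dotC ler_pdivrMl//.
apply: le_trans k3' _; rewrite ler_pdivrMl// dotC.
apply: le_trans (H k' k k1' k1 k2' k2) _.
by rewrite le_eqVlt; apply/orP; left; apply/eqP; ring.
Qed.

End lattice_bounds.

(** * Tail bounds and numeric constants *)

Section gaussian_tails.
Context {R : realType} {d : measure_display} {T : measurableType d}
  {P : probability T R} {I : choiceType} (Y : I -> {RV P >-> R}).
Variables (m sg : I -> R).
Hypothesis sg0 : forall i, sg i != 0.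
Hypothesis YN : forall i A, measurable A ->
  distribution P (Y i) A = normal_prob (m i) (sg i) A.
Hypothesis Yind : indep_RVs P Y.
Let Z i w := Y i w - m i.

Lemma gaussian_linear_tail s r (c : I -> T -> R) (v a : R) : uniq (r ++ s) ->
  (forall i, measurable_fun setT (c i : generated Y s -> R)) -> 0 < v -> 0 < a ->
  (forall w, \sum_(i <- r) c i w ^+ 2 * sg i ^+ 2 <= v) ->
  (P [set w | (a <= \sum_(i <- r) c i w * Z i w)%R] <= (expR (- (a ^+ 2 / (2 * v))))%:E)%E.
Proof.
move=> u mc v0 a0 cv; pose k := a / v; have k0 : 0 < k by rewrite divr_gt0.
have -> : - (a ^+ 2 / (2 * v)) = k ^+ 2 * v / 2 - k * a by rewrite /k; field; rewrite gt_eqF.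
rewrite [X in P X](_ : _ = [set w | (k * a <= \sum_(i <- r) (k * c i w) * Z i w)%R]); last first.
  have E w : \sum_(i <- r) (k * c i w) * Z i w = k * \sum_(i <- r) c i w * Z i w.
    by rewrite mulr_sumr; apply: eq_bigr => i _; rewrite mulrA.
  by apply/seteqP; split => w /=; rewrite E ler_pM2l.
have mkc i : measurable_fun setT ((fun w => k * c i w) : generated Y s -> R).
  exact: measurable_funM.
apply: exponential_markov.
  apply: measurable_sum => i; apply: measurable_funM.
    exact: measurable_generated (mkc i).
  exact: measurable_funB.
under eq_integral do rewrite -[expR _]mul1r.
rewrite (gaussian_linear_mgf sg0 YN Yind (psi := fun=> 1) u mkc)//.
rewrite -[leRHS](integral_probability_cst P).
apply: ge0_le_integral => //.
- apply/measurable_EFinP; apply: measurable_funM => //; apply: measurableT_comp => //.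
  apply: measurable_sum => i; do 2 apply: measurable_funM => //; apply: measurable_funX.
  exact: measurable_generated (mkc i).
move=> w _; rewrite lee_fin mul1r ler_expR.
rewrite -mulr_suml ler_pM2r ?invr_gt0//.
under eq_bigr do rewrite exprMn -mulrA.
by rewrite -mulr_sumr ler_pM2l ?exprn_gt0.
Qed.

Lemma gaussian_lower_tail (rs : seq (seq I)) (b : I -> R) (v q : R) :
  uniq (flatten rs) -> 0 < v -> 0 < q -> q < 1 ->
  (forall r, r \in rs -> \sum_(i <- r) b i ^+ 2 * sg i ^+ 2 = v) ->
  (P [set w | (\sum_(r <- rs) (\sum_(i <- r) b i * Z i w) ^+ 2 <= q * (size rs)%:R * v)%R]
    <= (expR (- ((q - 1 - ln q) / 2 * (size rs)%:R)))%:E)%E.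
Proof.
move=> u v0 q0 q1 bv.
(* The optimal tilt for a lower tail; it is negative and makes [1 - 2 * th * v] equal to [q^-1]. *)
pose th := - ((q^-1 - 1) / (2 * v)).
have qV : 1 < q^-1 by rewrite invf_gt1.
have thp : 0 < - th by rewrite opprK divr_gt0 ?mulr_gt0// subr_gt0.
have thv : 1 - 2 * th * v = q^-1 by rewrite /th; field; rewrite !gt_eqF.
have -> : - ((q - 1 - ln q) / 2 * (size rs)%:R) =
    - ln (1 - 2 * th * v) / 2 * (size rs)%:R - th * (q * (size rs)%:R * v).
  by rewrite thv lnV// /th; field; rewrite !gt_eqF.
rewrite [X in P X](_ : _ = [set w | (th * (q * (size rs)%:R * v) <=
    th * \sum_(r <- rs) (\sum_(i <- r) b i * Z i w) ^+ 2)%R]); last first.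
  apply/seteqP; split => w /= h.
    by rewrite -lerN2 -!mulNr ler_pM2l.
  by move: h; rewrite -lerN2 -!mulNr ler_pM2l.
apply: exponential_markov.
  apply: measurable_funM => //; apply: measurable_sum => r; apply: measurable_funX.
  by apply: measurable_sum => i; apply: measurable_funM => //; exact: measurable_funB.
apply: (@gaussian_rows_mgf_le _ _ _ P I Y m sg sg0 YN Yind [::] rs th v (fun i _ => b i)).
- by rewrite cats0.
- by [].
- by move=> w r rrs; rewrite bv.
- by rewrite -subr_gt0 thv invr_gt0.
Qed.

Lemma gaussian_upper_tail (rs : seq (seq I)) (b : I -> R) (v : R) :
  uniq (flatten rs) -> 0 < v ->
  (forall r, r \in rs -> \sum_(i <- r) b i ^+ 2 * sg i ^+ 2 = v) ->
  (P [set w | (2 * (size rs)%:R * v <= \sum_(r <- rs) (\sum_(i <- r) b i * Z i w) ^+ 2)%R]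
    <= (expR (- ((1 - ln 2) / 2 * (size rs)%:R)))%:E)%E.
Proof.
move=> u v0 bv.
pose th := (4 * v)^-1.
have th0 : 0 < th by rewrite invr_gt0 mulr_gt0.
have thv : 1 - 2 * th * v = 2^-1 by rewrite /th; field; rewrite gt_eqF.
have -> : - ((1 - ln 2) / 2 * (size rs)%:R) =
    - ln (1 - 2 * th * v) / 2 * (size rs)%:R - th * (2 * (size rs)%:R * v).
  have -> : th * (2 * (size rs)%:R * v) = (size rs)%:R / 2 by rewrite /th; field; rewrite gt_eqF.
  have -> : ln (1 - 2 * th * v) = - ln 2 by rewrite thv lnV// posrE.
  by move: (ln 2) => x; field.
rewrite [X in P X](_ : _ = [set w | (th * (2 * (size rs)%:R * v) <=
    th * \sum_(r <- rs) (\sum_(i <- r) b i * Z i w) ^+ 2)%R]); last first.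
  by apply/seteqP; split => w /=; rewrite ler_pM2l.
apply: exponential_markov.
  apply: measurable_funM => //; apply: measurable_sum => r; apply: measurable_funX.
  by apply: measurable_sum => i; apply: measurable_funM => //; exact: measurable_funB.
apply: (@gaussian_rows_mgf_le _ _ _ P I Y m sg sg0 YN Yind [::] rs th v (fun i _ => b i)).
- by rewrite cats0.
- by [].
- by move=> w r rrs; rewrite bv.
- by rewrite -subr_gt0 thv invr_gt0.
Qed.

End gaussian_tails.

Section union_bound.
Context {R : realType} {d : measure_display} {T : measurableType d} (P : probability T R).

Lemma union_bound (K : finType) (S : {set K}) (A : K -> set T) (p : R) :
  (forall k, measurable (A k)) -> (forall k, k \in S -> P (A k) <= p%:E)%E ->
  (P (\big[setU/set0]_(k in S) A k) <= (#|S|%:R * p)%:E)%E.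
Proof.
move=> mA Ap.
suff H (r : seq K) : (forall k, k \in r -> (P (A k) <= p%:E)%E) ->
    (P (\big[setU/set0]_(k <- r) A k) <= ((size r)%:R * p)%:E)%E.
  by rewrite -big_enum cardE; apply: H => k; rewrite mem_enum; exact: Ap.
elim: r => [_|k r IH Hr]; first by rewrite big_nil measure0 mul0r.
rewrite big_cons; apply: le_trans (measureU2 _ _ _) _ => //.
  exact: bigsetU_measurable.
rewrite /= mulrS mulrDl mul1r EFinD; apply: leeD; first by apply: Hr; rewrite mem_head.
by apply: IH => j jr; apply: Hr; rewrite inE jr orbT.
Qed.

End union_bound.

(** * Measurability of the matrix inverse *)

Section measurable_inverse.
Context {R : realType} {d : measure_display} {T : measurableType d}.

Lemma measurable_det n (M : T -> 'M[R]_n) :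
  (forall i j, measurable_fun setT (fun w => M w i j)) ->
  measurable_fun setT (fun w => \det (M w)).
Proof.
move=> mM; apply: measurable_sum => s; apply: measurable_funM => //.
by apply: measurable_prod => i _.
Qed.

Lemma measurable_invmx n (M : T -> 'M[R]_n) i j :
  (forall i j, measurable_fun setT (fun w => M w i j)) ->
  measurable_fun setT (fun w => invmx (M w) i j).
Proof.
move=> mM; have md := measurable_det mM.
(* [invmx] returns a singular matrix unchanged, hence the first branch. The reciprocal of the
   determinant is written through [expR] and [ln] of its square, which are measurable whatever its
   sign. *)
rewrite (_ : (fun _ => _) = fun w => if \det (M w) == 0 then M w i j else
    (\det (M w) * expR (- ln (\det (M w) ^+ 2))) * \adj (M w) i j); last first.
  apply/funext => w; rewrite /invmx unitmxE unitfE; case: eqP => //= /eqP d0.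
  have d2 : 0 < \det (M w) ^+ 2 by rewrite exprn_even_gt0.
  by rewrite mxE expRN lnK// expr2; congr (_ * _); field.
apply: measurable_fun_ifT.
- exact: measurable_fun_eqr.
- exact: mM.
apply: measurable_funM.
  apply: measurable_funM => //; apply: measurableT_comp => //; apply: measurableT_comp => //.
  by apply: measurableT_comp => //; exact: measurable_funX.
under eq_fun do rewrite mxE /cofactor.
apply: measurable_funM => //; apply: measurable_det => k l.
by under eq_fun do rewrite !mxE; exact: mM.
Qed.

End measurable_inverse.

(** * Numerical constants of the union bounds *)

Section numeric_constants.
Context {R : realType}.

Lemma expR_le_frac (x : R) : x < 1 -> expR x <= (1 - x)^-1.
Proof.
move=> x1; rewrite -[x]opprK expRN lef_pV2 ?posrE ?expR_gt0 ?subr_gt0 ?opprK//.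
exact: expR_ge1Dx.
Qed.

Lemma expR_quarter : expR (4^-1) <= 103 / 80 :> R.
Proof.
have e64 : expR (64^-1) <= 64 / 63 :> R.
  have -> : 64 / 63 = (1 - 64^-1)^-1 :> R by field.
  by apply: expR_le_frac; lra.
have -> : 4^-1 = 16%:R * 64^-1 :> R by field.
rewrite expRM_natl.
apply: (@le_trans _ _ ((64 / 63) ^+ 16)); last by lra.
by rewrite lerXn2r ?nnegrE ?expR_ge0//; lra.
Qed.

(** The balance per dimension in the lattice union bound: growth of the count against decay of the
    tail. The margin is thin, since with 27 for the exponential the product is still about 0.9965;
    this is why [expR_quarter] has to be sharp. *)
Lemma lattice_rate_constant : (6 / 5) ^+ 5 * 12 * ((3 / 16) ^+ 4 * expR (13 / 4)) <= 1 :> R.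
Proof.
have e13 : expR (13 / 4) <= 27 :> R.
  rewrite expRM_natl; apply: (@le_trans _ _ ((103 / 80) ^+ 13)); last by lra.
  by apply: lerXn2r; rewrite ?nnegrE ?expR_ge0 ?divr_ge0//; exact: expR_quarter.
by move: (expR (13 / 4)) e13 => x; lra.
Qed.

Lemma ln2_le : ln 2 <= 3 / 4 :> R.
Proof.
rewrite -[leRHS]expRK ler_ln ?posrE ?expR_gt0//.
have -> : 3 / 4 = 6%:R * 8^-1 :> R by field.
rewrite expRM_natl; apply: (@le_trans _ _ ((1 + 8^-1) ^+ 6)); first by lra.
by rewrite lerXn2r ?nnegrE ?expR_ge0 ?expR_ge1Dx//; lra.
Qed.

Lemma lattice_rate_ge : 4^-1 <= 3 / 16 - 1 - ln (3 / 16) :> R.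
Proof.
have e54 : expR (5 / 4) <= 16 / 3 :> R.
  rewrite expRM_natl; apply: (@le_trans _ _ ((103 / 80) ^+ 5)); last by lra.
  by apply: lerXn2r; rewrite ?nnegrE ?expR_ge0 ?divr_ge0//; exact: expR_quarter.
have e1 : ln (3 / 16) <= - (5 / 4) :> R.
  rewrite -[leRHS]expRK ler_ln ?posrE ?expR_gt0 ?divr_gt0//.
  by rewrite expRN -[leLHS]invf_div lef_pV2 ?posrE ?expR_gt0 ?divr_gt0.
by lra.
Qed.

(** The two terms of t1 are spent separately. The part [8 * n] yields [expR (- (4 * rho))] per
    dimension, which beats the number of codes; the part [16 * L] yields [expR (- (8 * rho * L))],
    enough because [rho] is at least 1/4. *)
Lemma lower_tail_union (n t : nat) (L : R) : 0 <= L -> 8 * n%:R + 16 * L <= t%:R ->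
  ((5 / 6) ^- 5 * (2 / (1 - 5 / 6))) ^+ n *
    expR (- ((3 / 16 - 1 - ln (3 / 16)) / 2 * t%:R)) <= expR (- (2 * L)).
Proof.
move=> L0 tn; set rho := _ - ln _.
have rho0 : 4^-1 <= rho by exact: lattice_rate_ge.
have -> : (5 / 6) ^- 5 * (2 / (1 - 5 / 6)) = (6 / 5) ^+ 5 * 12 :> R by field.
have rhoE : expR (- (4 * rho)) = (3 / 16) ^+ 4 * expR (13 / 4).
  have -> : - (4 * rho) = ln (3 / 16) *+ 4 + 13 / 4 by rewrite -mulr_natr /rho; field.
  by rewrite expRD -lnXn ?divr_gt0// lnK// posrE exprn_gt0// divr_gt0.
have le1 : (((6 / 5) ^+ 5 * 12) * expR (- (4 * rho))) ^+ n <= 1.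
  rewrite exprn_ile1 ?mulr_ge0 ?expR_ge0//; rewrite rhoE; exact: lattice_rate_constant.
have rle : expR (- (rho / 2 * t%:R)) <= expR (- (4 * rho)) ^+ n * expR (- (2 * L)).
  rewrite -expRM_natl -expRD ler_expR.
  have : rho * (8 * n%:R + 16 * L) <= rho * t%:R by rewrite ler_wpM2l//; lra.
  have : 4^-1 * L <= rho * L by rewrite ler_wpM2r.
  by lra.
apply: (@le_trans _ _ (((6 / 5) ^+ 5 * 12) ^+ n * (expR (- (4 * rho)) ^+ n * expR (- (2 * L))))).
  by rewrite ler_wpM2l// exprn_ge0// mulr_ge0.
by rewrite mulrA -exprMn ler_piMl// expR_ge0.
Qed.

Lemma trace_tail (n t : nat) (L : R) : (0 < n)%N -> 16 * L <= t%:R ->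
  expR (- ((1 - ln 2) / 2 * (t * n)%:R)) <= expR (- (2 * L)).
Proof.
move=> n0 tL; rewrite ler_expR lerN2.
have := @ln2_le; set x := ln 2 => x34.
have tn : t%:R <= (t * n)%:R :> R by rewrite ler_nat leq_pmulr.
have : 8^-1 * (t * n)%:R <= (1 - x) / 2 * (t * n)%:R by rewrite ler_wpM2r//; lra.
by lra.
Qed.

(** There are at most 27/2 codes per dimension and each dimension gains [delta / 9], leaving
    [3 / 2 * delta] to the power [N]. A single factor would exceed [delta]; two factors suffice when
    [delta] is at most 1/4. *)
Lemma operator_tail_union (N : nat) (delta : R) : (2 <= N)%N -> 0 < delta -> delta <= 4^-1 ->
  ((2 / 3) ^- 2 * (2 / (1 - 2 / 3))) ^+ N * expR (- (N%:R * ln (9 / delta))) <= delta.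
Proof.
move=> N2 d0 d4.
have -> : (2 / 3) ^- 2 * (2 / (1 - 2 / 3)) = 27 / 2 :> R by field.
have -> : expR (- (N%:R * ln (9 / delta))) = (delta / 9) ^+ N.
  rewrite -mulrN expRM_natl expRN lnK ?posrE ?divr_gt0// invf_div//.
rewrite -exprMn -(subnK N2) exprD.
have -> : 27 / 2 * (delta / 9) = 3 / 2 * delta by field.
apply: (@le_trans _ _ (1 * (3 / 2 * delta) ^+ 2)); last by nra.
by rewrite ler_wpM2r ?sqr_ge0// exprn_ile1//; lra.
Qed.

End numeric_constants.

(** * Algebra of the least-squares error *)

Section gram_matrix.
Context {R : realType} {J : finType} {n : nat}.
Variable x : J -> 'cV[R]_n.

Definition gram := \sum_j x j *m (x j)^T.

Lemma gram_sym : gram^T = gram.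
Proof. by rewrite [LHS]linear_sum /=; apply: eq_bigr => j _; rewrite trmx_mul trmxK. Qed.

Lemma mulmx_gram v : gram *m v = \sum_j dot (x j) v *: x j.
Proof. by rewrite mulmx_suml; apply: eq_bigr => j _; rewrite mulmx_outer. Qed.

Lemma dot_gram v : dot v (gram *m v) = \sum_j dot (x j) v ^+ 2.
Proof.
rewrite mulmx_gram dot_sumr; apply: eq_bigr => j _.
by rewrite dotZr [dot v _]dotC -expr2.
Qed.

(** The left side is <v, y>, where [y] is the inverse Gram matrix applied to [v]. The lower bound
    gives L |y|^2 <= <v, y>, and Cauchy-Schwarz between [v] and [y] finishes. *)
Lemma dot_sqr_sum_invmx_gram (L : R) v : 0 < L ->
  (forall v, L * dot v v <= \sum_j dot (x j) v ^+ 2) ->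
  \sum_j dot (invmx gram *m x j) v ^+ 2 <= dot v v / L.
Proof.
move=> L0 low.
have lowg u : L * dot u u <= dot u (gram *m u) by rewrite dot_gram.
have gu : gram \in unitmx := positive_unitmx L0 gram_sym lowg.
pose y := invmx gram *m v.
have gy : gram *m y = v by rewrite mulmxA mulmxV// mul1mx.
have -> : \sum_j dot (invmx gram *m x j) v ^+ 2 = dot v y.
  rewrite -gy dotC dot_gram; apply: eq_bigr => j _; congr (_ ^+ 2).
  by rewrite gy dotC dot_mulmx trmx_inv gram_sym dotC.
have ly : L * dot y y <= dot v y by rewrite -gy dotC.
have y0 : 0 <= dot v y by apply: le_trans ly; rewrite mulr_ge0 ?dot_ge0// ltW.
have cs := cauchy_schwarz v y.
rewrite ler_pdivlMr//.
have [->|vy0] := eqVneq (dot v y) 0; first by rewrite mul0r dot_ge0.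
have vyp : 0 < dot v y by rewrite lt_def vy0.
rewrite -(ler_pM2r vyp).
have : dot v v * (L * dot y y) <= dot v v * dot v y by rewrite ler_wpM2l ?dot_ge0.
by move: (ler_wpM2l (ltW L0) cs); rewrite expr2; lra.
Qed.

End gram_matrix.

Section least_squares_error.
Context {R : realType} {n l : nat}.

Lemma least_squares_error (J : finType) (Theta : 'M[R]_(l, n)) (x : J -> 'cV[R]_n)
    (eta : J -> 'cV[R]_l) : gram x \in unitmx ->
  (\sum_j (Theta *m x j + eta j) *m (x j)^T) *m Defs.pinv (gram x) - Theta =
  \sum_j eta j *m (invmx (gram x) *m x j)^T.
Proof.
move=> gu; rewrite pinv_unit//.
have -> : \sum_j (Theta *m x j + eta j) *m (x j)^T =
    Theta *m gram x + \sum_j eta j *m (x j)^T.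
  rewrite mulmx_sumr -big_split; apply: eq_bigr => j _ /=.
  by rewrite mulmxDl mulmxA.
rewrite mulmxDl -mulmxA mulmxV// mulmx1.
rewrite addrAC subrr add0r mulmx_suml; apply: eq_bigr => j _.
by rewrite trmx_mul trmx_inv gram_sym mulmxA.
Qed.

End least_squares_error.

Section regularized_mean_gram.
Context {R : realType} {n : nat}.
Variables (mu : nat -> 'cV[R]_n.+1) (sx muhat : R) (t : nat).
Hypotheses (sx0 : 0 < sx) (muhat0 : 0 <= muhat) (t0 : (0 < t)%N).
Hypothesis mub : forall j, vnorm (mu j) <= muhat.

Let V := t%:R * sx ^+ 2.
Let A := 1%:M + mubar mu sx t.

Let V0 : 0 < V. Proof. by rewrite mulr_gt0 ?ltr0n// exprn_gt0. Qed.

Let AE : A = 1%:M + (4 / V) *: gram (fun j : 'I_t => mu j).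
Proof. by []. Qed.

Let dotA v : dot v (A *m v) = dot v v + 4 / V * \sum_(j < t) dot (mu j) v ^+ 2.
Proof. by rewrite AE mulmxDl mul1mx dotDr -scalemxAl dotZr dot_gram. Qed.

Let A_sym : A^T = A.
Proof. by rewrite AE linearD linearZ/= gram_sym trmx1. Qed.

Let A_ge1 v : 1 * dot v v <= dot v (A *m v).
Proof.
rewrite mul1r dotA lerDl mulr_ge0 ?sumr_ge0// => [|j _]; last exact: sqr_ge0.
by rewrite divr_ge0// ltW.
Qed.

Lemma lambda_min_regularized_ge1 : 1 <= lambda_min A.
Proof. exact: lambda_min_ge A_sym A_ge1. Qed.

Lemma lambda_min_regularized_rayleigh v :
  lambda_min A * dot v v <= dot v v + 4 / V * \sum_(j < t) dot (mu j) v ^+ 2.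
Proof. by rewrite -dotA; exact: lambda_min_rayleigh A_sym A_ge1 v. Qed.

Lemma lambda_min_regularized_le :
  lambda_min A <= 1 + 4 * muhat ^+ 2 / (n.+1%:R * sx ^+ 2).
Proof.
have n0 : 0 < n.+1%:R :> R by rewrite ltr0n.
have mu2 j : dot (mu j) (mu j) <= muhat ^+ 2.
  by rewrite -vnorm_sqr ler_sqr ?nnegrE ?sqrtr_ge0.
(* Summing the Rayleigh inequality over the standard basis compares [n.+1] times [lambda_min A] with
   the trace of [A]. *)
have : \sum_(i < n.+1) lambda_min A <=
    \sum_(i < n.+1) (1 + 4 / V * \sum_(j < t) mu j i 0 ^+ 2).
  apply: ler_sum => i _; have := lambda_min_regularized_rayleigh (delta_mx i 0).
  rewrite dot_delta mxE !eqxx/= mulr1.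
  by under eq_bigr do rewrite dot_delta.
rewrite sumr_const card_ord big_split/= sumr_const card_ord -mulr_sumr exchange_big/=.
have : \sum_(j < t) \sum_(i < n.+1) mu j i 0 ^+ 2 <= t%:R * muhat ^+ 2.
  rewrite mulr_natl -[t in leRHS](card_ord t) -sumr_const; apply: ler_sum => j _.
  apply: le_trans (mu2 j); rewrite le_eqVlt; apply/orP; left; apply/eqP.
  by apply: eq_bigr => i _; rewrite expr2.
move=> /(ler_wpM2l (divr_ge0 (ler0n R 4) (ltW V0))) h.
rewrite -[X in X <= _]mulr_natl => h'.
rewrite -(ler_pM2l n0); apply: le_trans h' _.
rewrite mulrDr mulr1 lerD2l; apply: le_trans h _.
rewrite le_eqVlt; apply/orP; left; apply/eqP.
rewrite /V; field; rewrite !gt_eqF ?ltr0n//.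
Qed.

End regularized_mean_gram.

Lemma error_rate_arithmetic {R : realType} (n l t : nat) (sx se muhat L L2 L9 lam X : R) :
  (0 < n)%N -> (0 < t)%N -> 0 < sx -> 0 < se -> 0 <= muhat -> 0 <= L -> L <= L2 -> 0 <= L9 ->
  1 <= lam -> lam <= 1 + 4 * muhat ^+ 2 / (n%:R * sx ^+ 2) ->
  let Lam := t%:R * sx ^+ 2 / 32 * lam in
  X <= se / Num.sqrt Lam * (4 * Num.sqrt 2 * Num.sqrt L9) ->
  X <= se / Num.sqrt Lam * (Num.sqrt n%:R * (Num.sqrt l%:R + Num.sqrt (2 * L))) ->
  X <= 8 * se * (4 * sx * Num.sqrt L9 + muhat * (Num.sqrt (2 * (l + n)%:R) + 2 * Num.sqrt L2))
       / (Num.sqrt t%:R * sx ^+ 2 * lam).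
Proof.
move=> n0 t0 sx0 se0 mh0 L0 LL2 L90 lam1 lamle Lam.
have nR : 0 < n%:R :> R by rewrite ltr0n.
have tR : 0 < t%:R :> R by rewrite ltr0n.
have lam0 : 0 < lam by exact: lt_le_trans lam1.
set sn := Num.sqrt n%:R; set st := Num.sqrt t%:R; set s2 := Num.sqrt 2.
set r := Num.sqrt lam.
have sn0 : 0 < sn by rewrite sqrtr_gt0.
have st0 : 0 < st by rewrite sqrtr_gt0.
have s20 : 0 < s2 by rewrite sqrtr_gt0.
have r0 : 0 < r by rewrite sqrtr_gt0.
have snn : sn ^+ 2 = n%:R by rewrite sqr_sqrtr// ltW.
have stt : st ^+ 2 = t%:R by rewrite sqr_sqrtr// ltW.
have s22 : s2 ^+ 2 = 2 by rewrite sqr_sqrtr.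
have rr : r ^+ 2 = lam by rewrite sqr_sqrtr// ltW.
have LamE : Num.sqrt Lam = st * sx * r / (4 * s2).
  have -> : Lam = (st * sx * r / (4 * s2)) ^+ 2.
    by rewrite expr_div_n !exprMn stt rr s22 /Lam; field.
  by rewrite sqrtr_sqr ger0_norm// divr_ge0 ?mulr_ge0 ?(ltW st0) ?(ltW sx0) ?(ltW r0) ?(ltW s20).
set B := Num.sqrt L9; set S := Num.sqrt l%:R + _; set G := Num.sqrt _ + 2 * Num.sqrt L2.
have B0 : 0 <= B by rewrite sqrtr_ge0.
have G0 : 0 <= G by rewrite addr_ge0 ?mulr_ge0 ?sqrtr_ge0.
have SG : s2 * S <= G.
  rewrite /S mulrDr lerD//.
    by rewrite /s2 -sqrtrM// ler_sqrt ?mulr_ge0// ler_pM2l// natrD lerDl.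
  rewrite sqrtrM// mulrA -/s2 -expr2 s22 ler_pM2l// ler_sqrt//.
  exact: le_trans LL2.
have rle : r <= 1 + 2 * (muhat / (sn * sx)).
  have q0 : 0 <= muhat / (sn * sx) by rewrite divr_ge0// ltW// mulr_gt0.
  have p0 : 0 <= 1 + 2 * (muhat / (sn * sx)).
    by move: (muhat / (sn * sx)) q0 => q; lra.
  rewrite -(@ler_pXn2r _ 2)// ?nnegrE ?(ltW r0)// rr; apply: le_trans lamle _.
  have -> : 4 * muhat ^+ 2 / (n%:R * sx ^+ 2) = 4 * (muhat / (sn * sx)) ^+ 2.
    by rewrite -snn; field; rewrite !gt_eqF.
  by move: (muhat / (sn * sx)) q0 => q q0; rewrite sqrrD; lra.
rewrite LamE => XA XB.
(* [F] is [X] measured in units of [se / Num.sqrt Lam]; the two hypotheses become [F <= 4 * s2 * B]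
   and [F <= sn * S]. *)
pose F := X * (st * sx * r) / (4 * s2 * se).
have XF : X = F * (4 * s2 * se) / (st * sx * r) by rewrite /F; field; rewrite !gt_eqF.
have c0 : 0 < st * sx * r / (4 * s2 * se) by rewrite divr_gt0 ?mulr_gt0.
have FA : F <= 4 * s2 * B.
  have := ler_wpM2r (ltW c0) XA; rewrite mulrA -/F.
  by have -> : se / (st * sx * r / (4 * s2)) * (4 * s2 * B) * (st * sx * r / (4 * s2 * se)) = 4 * s2 * B
    by field; rewrite !gt_eqF.
have FB : F <= sn * S.
  have := ler_wpM2r (ltW c0) XB; rewrite mulrA -/F.
  by have -> : se / (st * sx * r / (4 * s2)) * (sn * S) * (st * sx * r / (4 * s2 * se)) = sn * S
    by field; rewrite !gt_eqF.
rewrite ler_pdivlMr ?mulr_gt0 ?exprn_gt0//.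
have -> : X * (st * sx ^+ 2 * lam) = 4 * se * (F * (s2 * sx * r)).
  by rewrite XF -rr; field; rewrite !gt_eqF.
have -> : 8 * se * (4 * sx * B + muhat * G) = 4 * se * (2 * (4 * sx * B + muhat * G)) by ring.
rewrite ler_pM2l ?mulr_gt0//.
have [F0|F0] := leP F 0.
  apply: (@le_trans _ _ 0).
    by rewrite mulr_le0_ge0 ?mulr_ge0 ?(ltW s20) ?(ltW sx0) ?(ltW r0).
  by rewrite mulr_ge0 ?addr_ge0 ?mulr_ge0 ?(ltW sx0).
(* The surplus factor [r] is split by [rle]: the summand 1 is met by [FA], the summand with [muhat]
   by [FB], where [sn] cancels. *)
apply: (@le_trans _ _ (F * (s2 * sx * (1 + 2 * (muhat / (sn * sx)))))).
  by rewrite ler_pM2l// ler_pM2l ?mulr_gt0.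
have -> : F * (s2 * sx * (1 + 2 * (muhat / (sn * sx)))) = F * s2 * sx + 2 * muhat * (F / sn * s2).
  by field; rewrite !gt_eqF.
rewrite mulrDr lerD//.
  have := ler_wpM2r (mulr_ge0 (ltW s20) (ltW sx0)) FA.
  have -> : 4 * s2 * B * (s2 * sx) = 2 * (4 * sx * B) by move: s22; rewrite expr2 => s22';
    rewrite -[in RHS]s22'; ring.
  by rewrite mulrA.
rewrite [leRHS]mulrA ler_wpM2l ?mulr_ge0//; apply: le_trans SG.
by rewrite mulrC ler_pM2l// ler_pdivrMr// mulrC.
Qed.

(** * The exceptional events *)

Section concentration.
Context {R : realType} {d : measure_display} {T : measurableType d}
  {P : probability T R} {n l : nat}.
Variables (sx se muhat delta : R) (mu : nat -> 'cV[R]_n.+1)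
  (X : nat -> 'I_n.+1 -> {RV P >-> R}) (E : nat -> 'I_l.+1 -> {RV P >-> R}) (t : nat).
Hypotheses (sx0 : 0 < sx) (se0 : 0 < se) (muhat0 : 0 <= muhat) (t0 : (0 < t)%N).
Hypothesis mub : forall j, vnorm (mu j) <= muhat.
Hypothesis Xlaw : forall j k A, measurable A ->
  distribution P (X j k) A = normal_prob (mu j k 0) sx A.
Hypothesis Elaw : forall j m A, measurable A ->
  distribution P (E j m) A = normal_prob 0 se A.
Hypothesis XEind : indep_RVs P (coord_family X E).
Hypotheses (delta0 : 0 < delta) (delta1 : delta <= 4^-1).

Local Notation idx := ((nat * 'I_n.+1) + (nat * 'I_l.+1))%type.
Let Y : idx -> {RV P >-> R} := coord_family X E.
Let m (i : idx) : R := if i is inl (j, k) then mu j k 0 else 0.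
Let sg (i : idx) : R := if i is inl _ then sx else se.
Let Z i w := Y i w - m i.
Let V := t%:R * sx ^+ 2.
Let L := ln (1 / delta).
Let L2 := ln (2 / delta).

Let tR : 0 < t%:R :> R. Proof. by rewrite ltr0n. Qed.
Let nR : 0 < n.+1%:R :> R. Proof. by rewrite ltr0n. Qed.
Let lR : 0 < l.+1%:R :> R. Proof. by rewrite ltr0n. Qed.
Let V0 : 0 < V. Proof. by rewrite mulr_gt0// exprn_gt0. Qed.
Let sg0 i : sg i != 0. Proof. by case: i => [[j k]|[j a]]; rewrite /= gt_eqF. Qed.

Let YN i A : measurable A -> distribution P (Y i) A = normal_prob (m i) (sg i) A.
Proof. by case: i => [[j k]|[j a]] mA; [exact: Xlaw|exact: Elaw]. Qed.

Let L0 : 0 < L.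
Proof. by rewrite ln_gt0// ltr_pdivlMr// mul1r; move: delta1; lra. Qed.

Let LL2 : L <= L2.
Proof. by rewrite ler_ln ?posrE ?divr_gt0// ler_pM2r ?invr_gt0//; lra. Qed.

Let expL : expR (- L) = delta.
Proof. by rewrite expRN lnK ?posrE ?divr_gt0// div1r invrK. Qed.

Let expL2 : expR (- (2 * L2)) = (delta / 2) ^+ 2.
Proof. by rewrite -mulrN expRM_natl expRN lnK ?posrE ?divr_gt0// invf_div. Qed.

Definition deviation (j : nat) (w : T) : 'cV[R]_n.+1 := \col_k (X j k w - mu j k 0).

Lemma xvec_deviation j w : xvec X j w = mu j + deviation j w.
Proof. by apply/matrixP => k i; rewrite ord1 !mxE addrC subrK. Qed.

(** The design coordinates are listed by time and by component, so that flattening the rows of each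
    design event gives one of the two lists. [ES] lists the noise by component, with [XS] as its
    conditioning list. *)
Let XS : seq idx := [seq inl (j, k) | j <- index_iota 0 t, k <- enum 'I_n.+1].
Let XS' : seq idx := [seq inl (j, k) | k <- enum 'I_n.+1, j <- index_iota 0 t].
Let ES : seq idx := [seq inr (j, a) | a <- enum 'I_l.+1, j <- index_iota 0 t].

Let XS_uniq : uniq XS.
Proof.
by apply: allpairs_uniq; rewrite ?iota_uniq ?enum_uniq// => -[j k] [j' k'] _ _ [-> ->].
Qed.

Let XS'_uniq : uniq XS'.
Proof.
by apply: allpairs_uniq; rewrite ?iota_uniq ?enum_uniq// => -[j k] [j' k'] _ _ [-> ->].
Qed.

Let ES_XS_uniq : uniq (ES ++ XS).
Proof.
rewrite cat_uniq XS_uniq andbT; apply/andP; split.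
  by apply: allpairs_uniq; rewrite ?iota_uniq ?enum_uniq// => -[j k] [j' k'] _ _ [-> ->].
by apply/hasPn => i /allpairsP[p [_ _ ->]]; apply/negP => /allpairsP[q [_ _]].
Qed.

Let measurable_Z i : measurable_fun setT (Z i).
Proof. exact: measurable_funB. Qed.

Let sum_time (F : nat -> R) : \sum_(j <- index_iota 0 t) F j = \sum_(j < t) F j.
Proof. by rewrite big_mkord. Qed.

Lemma trace_event : 8 * n.+1%:R + 16 * L2 <= t%:R ->
  exists B : set T, [/\ measurable B, (P B <= ((delta / 2) ^+ 2)%:E)%E &
    forall w, ~ B w ->
      \sum_(j < t) dot (deviation j w) (deviation j w) <= 2 * n.+1%:R * V].
Proof.
move=> tn; pose rs := [seq [:: i] | i <- XS].
have fl : flatten rs = XS by rewrite /rs; elim: XS => //= i s ->.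
have szrs : size rs = (t * n.+1)%N.
  by rewrite size_map size_allpairs size_iota subn0 size_enum_ord.
pose f w := \sum_(r <- rs) (\sum_(i <- r) 1 * Z i w) ^+ 2.
have mf : measurable_fun setT f.
  apply: measurable_sum => r; apply: measurable_funX; apply: measurable_sum => i.
  exact: measurable_funM.
exists [set w | 2 * (size rs)%:R * sx ^+ 2 <= f w]; split.
- exact: measurable_superlevel.
- rewrite -expL2; apply: le_trans.
    apply: (gaussian_upper_tail (I := idx) sg0 YN XEind (b := fun=> 1)).
    + by rewrite fl.
    + by rewrite exprn_gt0.
    + move=> r /mapP[i /allpairsP[p [_ _ ->]] ->].
      by rewrite big_seq1 expr1n mul1r.
  rewrite lee_fin szrs; apply: trace_tail => //.
  by apply: le_trans tn; rewrite lerDr mulr_ge0.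
- move=> w /negP; rewrite -ltNge szrs => /ltW.
  have -> : f w = \sum_(j < t) dot (deviation j w) (deviation j w).
    rewrite /f big_map big_allpairs_dep sum_time; apply: eq_bigr => j _.
    rewrite big_enum; apply: eq_bigr => k _.
    by rewrite big_seq1 mul1r !mxE expr2.
  by move=> h; apply: le_trans h _; rewrite natrM /V le_eqVlt; apply/orP; left; apply/eqP; ring.
Qed.

Lemma lattice_event : 8 * n.+1%:R + 16 * L2 <= t%:R ->
  exists B : set T, [/\ measurable B, (P B <= ((delta / 2) ^+ 2)%:E)%E &
    forall w, ~ B w -> forall k : {ffun 'I_n.+1 -> bool * 'I_(4 * n.+1 + 2)},
      (\sum_i (k i).2 <= 5 * n.+1)%N ->
      3 / 16 * V * dot (lattice_point k) (lattice_point k)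
        <= \sum_(j < t) dot (deviation j w) (lattice_point k) ^+ 2].
Proof.
move=> tn; pose rs : seq (seq idx) :=
  [seq [seq inl (j, k) | k <- enum 'I_n.+1] | j <- index_iota 0 t].
have szrs : size rs = t by rewrite size_map size_iota subn0.
pose K := {ffun 'I_n.+1 -> bool * 'I_(4 * n.+1 + 2)}.
pose pt (k : K) : 'cV[R]_n.+1 := lattice_point k.
pose b (k : K) (i : idx) : R := if i is inl (j, c) then pt k c 0 else 0.
pose f k w := \sum_(r <- rs) (\sum_(i <- r) b k i * Z i w) ^+ 2.
have mf k : measurable_fun setT (f k).
  apply: measurable_sum => r; apply: measurable_funX; apply: measurable_sum => i.
  exact: measurable_funM.
have fE k w : f k w = \sum_(j < t) dot (deviation j w) (pt k) ^+ 2.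
  rewrite /f big_map sum_time; apply: eq_bigr => j _; congr (_ ^+ 2).
  rewrite big_map big_enum; apply: eq_bigr => c _ /=.
  by rewrite mulrC !mxE.
pose A k := [set w | f k w <= 3 / 16 * (size rs)%:R * (sx ^+ 2 * dot (pt k) (pt k))].
have mA k : measurable (A k) by exact: measurable_sublevel.
(* Codes of the zero vector are left out because the lower tail needs positive variance; for them
   the inequality is trivial. *)
pose S := [set k : K | (\sum_i (k i).2 <= 5 * n.+1)%N && (pt k != 0)]%SET.
exists (\big[setU/set0]_(k in S) A k); split.
- exact: bigsetU_measurable.
- apply: le_trans.
    apply: (@union_bound _ _ _ P K S A (expR (- ((3 / 16 - 1 - ln (3 / 16)) / 2 * t%:R)))) => //.
    move=> k; rewrite inE => /andP[_ k0]; rewrite -[t in leRHS]szrs.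
    apply: (gaussian_lower_tail (I := idx) sg0 YN XEind); first exact: XS_uniq.
    + by rewrite mulr_gt0 ?exprn_gt0 ?dot_gt0.
    + by rewrite divr_gt0.
    + by lra.
    + move=> r /mapP[j _ ->]; rewrite big_map big_enum/= mulrC mulr_suml.
      by apply: eq_bigr => c _; rewrite expr2.
  rewrite -expL2 lee_fin; apply: le_trans (lower_tail_union (ltW (lt_le_trans L0 LL2)) tn).
  rewrite ler_wpM2r ?expR_ge0//.
  have h1 : 0 < (5 / 6 : R) by lra.
  have h2 : (5 / 6 : R) < 1 by lra.
  apply: le_trans (@lattice_count R n.+1 (4 * n.+1 + 2) 5 _ h1 h2).
  rewrite ler_nat subset_leq_card//; apply/fintype.subsetP => k; by rewrite !inE => /andP[].
- move=> w Bw k kS; have [pk0|pk0] := eqVneq (pt k) 0.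
    by rewrite [lattice_point k]pk0 dot0r mulr0 sumr_ge0// => j _; rewrite sqr_ge0.
  rewrite -/(pt k) -fE leNgt; apply/negP => /ltW lt; apply: Bw.
  have kinS : k \in S by rewrite inE kS.
  rewrite (bigD1 k)//=; left; rewrite /A/= szrs.
  by apply: le_trans lt _; rewrite /V le_eqVlt; apply/orP; left; apply/eqP; ring.
Qed.

Lemma cross_event :
  (16 * muhat * (Num.sqrt (4 * n.+1%:R) + Num.sqrt (2 * L2)) / sx) ^+ 2 <= t%:R ->
  exists B : set T, [/\ measurable B, (P B <= delta%:E)%E &
    forall w, ~ B w ->
      \sum_i \sum_k (\sum_(j < t) deviation j w i 0 * mu j k 0) ^+ 2 <= (V / 16) ^+ 2].
Proof.
set Q := Num.sqrt (4 * _) + _ => tmu.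
pose rs : seq (seq idx) :=
  [seq [seq inl (j, k) | j <- index_iota 0 t] | k <- enum 'I_n.+1].
have szrs : size rs = n.+1 by rewrite size_map size_enum_ord.
have sn0 : 0 < Num.sqrt (4 * n.+1%:R : R) by rewrite sqrtr_gt0 mulr_gt0.
have Q0 : 0 < Q by rewrite ltr_wpDr// sqrtr_ge0.
(* The largest bound on the means that the t2 hypothesis allows. Unlike [muhat] it is always
   positive, and it makes [v * Q ^+ 2] exactly [(V / 16) ^+ 2]. *)
pose mu' := Num.sqrt t%:R * sx / (16 * Q).
have st0 : 0 < Num.sqrt (t%:R : R) by rewrite sqrtr_gt0.
have mu'0 : 0 < mu' by rewrite divr_gt0 ?mulr_gt0.
have mule : muhat <= mu'.
  have y0 : 0 <= 16 * muhat * Q / sx by rewrite !mulr_ge0 ?invr_ge0 ?(ltW Q0) ?(ltW sx0).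
  have : 16 * muhat * Q / sx <= Num.sqrt t%:R.
    by rewrite -(ger0_norm y0) -sqrtr_sqr ler_sqrt.
  rewrite ler_pdivrMr// => h; rewrite /mu' ler_pdivlMr ?mulr_gt0//.
  by apply: le_trans h; rewrite le_eqVlt; apply/orP; left; apply/eqP; ring.
have mu2 : mu' ^+ 2 = V / (256 * Q ^+ 2).
  rewrite /mu' expr_div_n !exprMn sqr_sqrtr ?ltW// /V; congr (_ / (_ * _)); ring.
pose v := sx ^+ 2 * (t%:R * mu' ^+ 2).
have tm0 : 0 < t%:R * mu' ^+ 2 by rewrite mulr_gt0 ?exprn_gt0.
have v0 : 0 < v by rewrite mulr_gt0 ?exprn_gt0.
pose b (a : 'I_n.+1) (i : idx) (w : T) : R := if i is inl (j, _) then mu j a 0 else 0.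
(* Jensen weights: the share of component [a] in the energy of the means. Their sum is at most 1
   since [muhat <= mu']. *)
pose p (a : 'I_n.+1) := (\sum_(j < t) mu j a 0 ^+ 2) / (t%:R * mu' ^+ 2).
pose f w := \sum_a \sum_(r <- rs) (\sum_(i <- r) b a i w * Z i w) ^+ 2.
have mf : measurable_fun setT f.
  apply: measurable_sum => a; apply: measurable_sum => r; apply: measurable_funX.
  apply: measurable_sum => i; apply: measurable_funM => //.
  by case: i => [[? ?]|?]; exact: measurable_cst.
have fE w : f w = \sum_i \sum_k (\sum_(j < t) deviation j w i 0 * mu j k 0) ^+ 2.
  rewrite /f exchange_big big_map big_enum; apply: eq_bigr => k _; apply: eq_bigr => a _.
  congr (_ ^+ 2); rewrite big_map sum_time; apply: eq_bigr => j _.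
  by rewrite mulrC mxE.
exists [set w | v * (Num.sqrt (size rs)%:R + Num.sqrt (2 * L)) ^+ 2 <= f w]; split.
- exact: measurable_superlevel.
- rewrite -expL; apply: (gaussian_quadratic_tail (I := idx) (s := [::]) sg0 YN XEind (p := p)) => //.
  + by rewrite cats0; exact: XS'_uniq.
  + by rewrite szrs.
  + by move=> a; rewrite divr_ge0 ?(ltW tm0)// sumr_ge0// => j _; rewrite sqr_ge0.
  + rewrite -mulr_suml ler_pdivrMr// mul1r exchange_big/= mulr_natl.
    rewrite -[t in leRHS](card_ord t) -sumr_const; apply: ler_sum => j _.
    apply: (@le_trans _ _ (muhat ^+ 2)); last first.
      by rewrite ler_sqr ?nnegrE// ltW.
    rewrite (_ : \sum_a _ = dot (mu j) (mu j)); last first.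
      by apply: eq_bigr => a _; rewrite expr2.
    by rewrite -vnorm_sqr ler_sqr ?nnegrE ?sqrtr_ge0.
  + by move=> a [[? ?]|?]; exact: measurable_cst.
  + move=> a w r /mapP[k _ ->]; rewrite big_map sum_time/= -mulr_suml.
    by rewrite /p /v [leRHS]mulrCA divfK ?gt_eqF// mulrC.
- move=> w /negP; rewrite -ltNge szrs -fE => /ltW h; apply: le_trans h _.
  have -> : (V / 16) ^+ 2 = v * Q ^+ 2.
    by rewrite /v mu2 /V; field; rewrite gt_eqF.
  rewrite ler_pM2l//; apply: lerXn2r; rewrite ?nnegrE ?addr_ge0 ?sqrtr_ge0// ?(ltW Q0)//.
  apply: lerD; apply: ler_wsqrtr; first by move: nR; lra.
  by rewrite ler_pM2l.
Qed.

(** * Noise bounds conditional on the design *)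

Section noise.
Variable Lam : R.
Hypothesis Lam0 : 0 < Lam.

Definition design_gram (w : T) := gram (fun j : 'I_t => xvec X j w).

(* Truncated at the level which the design matrix guarantees on the good event,
   so that the exponential moments below are bounded unconditionally. *)
Definition noise_weight (v : 'cV[R]_n.+1) (j : nat) (w : T) : R :=
  let q (i : nat) := dot (invmx (design_gram w) *m xvec X i w) v in
  if \sum_(i < t) q i ^+ 2 <= dot v v / Lam then q j else 0.

Lemma noise_weight_sum v w : \sum_(j < t) noise_weight v j w ^+ 2 <= dot v v / Lam.
Proof.
pose q (i : nat) := dot (invmx (design_gram w) *m xvec X i w) v.
have E' (j : nat) : noise_weight v j w =
    if \sum_(i < t) q i ^+ 2 <= dot v v / Lam then q j else 0 by [].
have [h|h] := boolP (\sum_(i < t) q i ^+ 2 <= dot v v / Lam).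
  by under eq_bigr do rewrite E' h.
rewrite big1 ?divr_ge0 ?dot_ge0 ?(ltW Lam0)// => j _.
by rewrite E' (negbTE h) expr0n.
Qed.

(** Cutting off at [t] makes the weight measurable with respect to the first [t] design vectors for
    every [j], as the moment lemmas require of all indices. *)
Let weight v j w := if (j < t)%N then noise_weight v j w else 0.

Lemma measurable_noise_weight v j :
  measurable_fun setT (weight v j : generated Y XS -> R).
Proof.
rewrite /weight; have [jt|_] := boolP (j < t)%N; last exact: measurable_cst.
have mX (i : nat) k : (i < t)%N -> measurable_fun setT (X i k : generated Y XS -> R).
  move=> it; apply: (@measurable_coordinate _ _ _ P _ Y XS (inl (i, k))).
  apply: (@allpairs_f _ _ _ (fun a b => inl (a, b) : idx)); last by rewrite mem_enum.
  by rewrite mem_index_iota.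
have mgram i k : measurable_fun setT ((fun w => design_gram w i k) : generated Y XS -> R).
  under eq_fun do rewrite /design_gram /gram summxE.
  apply: measurable_sum => a; under eq_fun do rewrite mxE big_ord1 !mxE.
  by apply: measurable_funM; exact: mX.
have mq (i : nat) : (i < t)%N -> measurable_fun setT
    ((fun w => dot (invmx (design_gram w) *m xvec X i w) v) : generated Y XS -> R).
  move=> it; apply: measurable_sum => k; apply: measurable_funM => //.
  under eq_fun do rewrite mxE; apply: measurable_sum => k'; apply: measurable_funM.
    exact: measurable_invmx.
  by under eq_fun do rewrite mxE; exact: mX.
rewrite /noise_weight; apply: measurable_fun_ifT => //; last exact: mq.
apply: measurable_fun_ler => //; apply: measurable_sum => i; apply: measurable_funX.
exact: mq.
Qed.

Lemma frobenius_event :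
  exists B : set T, [/\ measurable B, (P B <= delta%:E)%E &
    forall w, ~ B w ->
      \sum_i \sum_a (\sum_(j < t) noise_weight (delta_mx i 0) j w * E j a w) ^+ 2
        <= se ^+ 2 * n.+1%:R / Lam * (Num.sqrt l.+1%:R + Num.sqrt (2 * L)) ^+ 2].
Proof.
pose rs : seq (seq idx) :=
  [seq [seq inr (j, a) | j <- index_iota 0 t] | a <- enum 'I_l.+1].
have szrs : size rs = l.+1 by rewrite size_map size_enum_ord.
(* Each basis vector has conditional variance at most [se ^+ 2 / Lam]; equal Jensen weights over
   [n.+1] of them put the factor [n.+1] here. *)
pose v := se ^+ 2 * n.+1%:R / Lam.
have v0 : 0 < v by rewrite divr_gt0 ?mulr_gt0 ?exprn_gt0.
pose b (c : 'I_n.+1) (i : idx) (w : T) : R :=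
  if i is inr (j, _) then weight (delta_mx c 0) j w else 0.
have mb c i : measurable_fun setT (b c i : generated Y XS -> R).
  case: i => [[j k]|[j a]]; [exact: measurable_cst|exact: measurable_noise_weight].
pose f w := \sum_c \sum_(r <- rs) (\sum_(i <- r) b c i w * Z i w) ^+ 2.
have mf : measurable_fun setT f.
  apply: measurable_sum => c; apply: measurable_sum => r; apply: measurable_funX.
  apply: measurable_sum => i; apply: measurable_funM => //.
  exact: measurable_generated (mb c i).
have fE w : f w = \sum_i \sum_a (\sum_(j < t) noise_weight (delta_mx i 0) j w * E j a w) ^+ 2.
  apply: eq_bigr => c _; rewrite big_map big_enum; apply: eq_bigr => a _.
  congr (_ ^+ 2); rewrite big_map sum_time; apply: eq_bigr => j _.
  by rewrite /b /weight ltn_ord /Z /m subr0.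
exists [set w | v * (Num.sqrt (size rs)%:R + Num.sqrt (2 * L)) ^+ 2 <= f w]; split.
- exact: measurable_superlevel.
- rewrite -expL; apply: (gaussian_quadratic_tail (I := idx) (s := XS) sg0 YN XEind
      (p := fun=> n.+1%:R^-1)) => //.
  + by rewrite szrs.
  + by rewrite sumr_const card_ord -[leLHS]mulr_natr mulVf// gt_eqF.
  + move=> c w r /mapP[a _ ->]; rewrite big_map sum_time/=.
    have -> : n.+1%:R^-1 * v = 1 / Lam * se ^+ 2 by rewrite /v; field; rewrite !gt_eqF.
    rewrite -mulr_suml ler_wpM2r ?sqr_ge0//.
    apply: le_trans (_ : \sum_(j < t) noise_weight (delta_mx c 0) j w ^+ 2 <= _).
      by rewrite le_eqVlt; apply/orP; left; apply/eqP; apply: eq_bigr => j _; rewrite /weight ltn_ord.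
    by have := noise_weight_sum (delta_mx c 0) w; rewrite dot_delta mxE !eqxx.
- by move=> w /negP; rewrite -ltNge szrs -fE => /ltW.
Qed.

Lemma operator_event :
  exists B : set T, [/\ measurable B, (P B <= delta%:E)%E &
    forall w, ~ B w ->
      forall (k' : {ffun 'I_l.+1 -> bool * 'I_(l.+1 + 2)})
        (k : {ffun 'I_n.+1 -> bool * 'I_(n.+1 + 2)}),
      (\sum_i (k' i).2 <= 2 * l.+1)%N -> (\sum_i (k i).2 <= 2 * n.+1)%N ->
      dot (lattice_point k' : 'cV[R]_l.+1) (lattice_point k') <= 4 * l.+1%:R ->
      dot (lattice_point k : 'cV[R]_n.+1) (lattice_point k) <= 4 * n.+1%:R ->
      \sum_a \sum_(j < t) lattice_point k' a 0 * noise_weight (lattice_point k) j w * E j a w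
      <= se / Num.sqrt Lam * (4 * Num.sqrt 2 * Num.sqrt ((n.+1 + l.+1)%:R * ln (9 / delta)))
         * (Num.sqrt l.+1%:R * Num.sqrt n.+1%:R)].
Proof.
set tau := se / _ * _.
have L90 : 0 < ln (9 / delta) by rewrite ln_gt0// ltr_pdivlMr// mul1r; move: delta1; lra.
have tau0 : 0 < tau by rewrite !mulr_gt0 ?invr_gt0 ?sqrtr_gt0 ?mulr_gt0 ?ltr0n.
pose K' := {ffun 'I_l.+1 -> bool * 'I_(l.+1 + 2)}.
pose K := {ffun 'I_n.+1 -> bool * 'I_(n.+1 + 2)}.
pose pt (k : K) : 'cV[R]_n.+1 := lattice_point k.
pose pt' (k : K') : 'cV[R]_l.+1 := lattice_point k.
pose S' := [set k : K' | (\sum_i (k i).2 <= 2 * l.+1)%N]%SET.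
pose S := [set k : K | (\sum_i (k i).2 <= 2 * n.+1)%N]%SET.
pose SS := [set kk : K' * K | [&& kk.1 \in S', kk.2 \in S,
  dot (pt' kk.1) (pt' kk.1) <= 4 * l.+1%:R & dot (pt kk.2) (pt kk.2) <= 4 * n.+1%:R]]%SET.
pose c (kk : K' * K) (i : idx) (w : T) : R :=
  if i is inr (j, a) then pt' kk.1 a 0 * weight (pt kk.2) j w else 0.
have mc kk i : measurable_fun setT (c kk i : generated Y XS -> R).
  case: i => [[j k]|[j a]]; first exact: measurable_cst.
  by apply: measurable_funM => //; exact: measurable_noise_weight.
pose f kk w := \sum_(i <- ES) c kk i w * Z i w.
have mf kk : measurable_fun setT (f kk).
  apply: measurable_sum => i; apply: measurable_funM => //.
  exact: measurable_generated (mc kk i).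
have fE kk w : f kk w =
    \sum_a \sum_(j < t) pt' kk.1 a 0 * noise_weight (pt kk.2) j w * E j a w.
  rewrite /f big_allpairs_dep big_enum; apply: eq_bigr => a _; rewrite sum_time.
  by apply: eq_bigr => j _; rewrite /c /weight ltn_ord /Z /m subr0.
pose a := tau * (Num.sqrt l.+1%:R * Num.sqrt n.+1%:R).
have a0 : 0 < a by apply: mulr_gt0 => //; apply: mulr_gt0; rewrite sqrtr_gt0.
(* The variance bound for lattice points of squared lengths [4 * l.+1] and [4 * n.+1]. The factor 4
   sqrt 2 in [tau] has square 2 * 4 * 4, so the dimensions cancel in [a ^+ 2 / (2 * v)]. *)
pose v := se ^+ 2 * (4 * l.+1%:R) * (4 * n.+1%:R) / Lam.
have v0 : 0 < v by rewrite divr_gt0 ?mulr_gt0 ?exprn_gt0.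
have av : a ^+ 2 / (2 * v) = (n.+1 + l.+1)%:R * ln (9 / delta).
  rewrite /a /tau !exprMn exprVn !sqr_sqrtr ?mulr_ge0 ?ltW// ?ltr0n//.
  by rewrite /v; move: (ln _) ((n.+1 + l.+1)%:R) => x y; field; rewrite !gt_eqF.
pose A kk := [set w | a <= f kk w].
exists (\big[setU/set0]_(kk in SS) A kk); split.
- by apply: bigsetU_measurable => kk _; exact: measurable_superlevel.
- apply: le_trans.
    apply: (@union_bound _ _ _ P _ SS A (expR (- (a ^+ 2 / (2 * v))))) => [kk|kk].
      exact: measurable_superlevel.
    rewrite inE => /and4P[_ _ n1 n2].
    apply: (gaussian_linear_tail (I := idx) (s := XS) sg0 YN XEind) => //.
    move=> w; rewrite big_allpairs_dep big_enum/=.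
    have -> : \sum_a0 \sum_(j <- index_iota 0 t) (pt' kk.1 a0 0 * weight (pt kk.2) j w) ^+ 2 * se ^+ 2
        = se ^+ 2 * dot (pt' kk.1) (pt' kk.1) * \sum_(j < t) noise_weight (pt kk.2) j w ^+ 2.
      rewrite /dot mulr_sumr mulr_suml; apply: eq_bigr => e _.
      rewrite sum_time mulr_sumr; apply: eq_bigr => j _.
      by rewrite /weight ltn_ord; ring.
    have d0 := dot_ge0 (pt' kk.1); have se2 : 0 < se ^+ 2 by rewrite exprn_gt0.
    rewrite /v -[leRHS]mulrA; apply: ler_pM.
    + by rewrite mulr_ge0// ltW.
    + by apply: sumr_ge0 => j _; rewrite sqr_ge0.
    + by rewrite ler_pM2l.
    + by apply: le_trans (noise_weight_sum _ _) _; rewrite ler_pM2r ?invr_gt0.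
  rewrite lee_fin av.
  have N2 : (2 <= n.+1 + l.+1)%N by rewrite addSn addnS.
  apply: le_trans (operator_tail_union N2 delta0 delta1).
  rewrite ler_wpM2r ?expR_ge0//.
  have h1 : 0 < (2 / 3 : R) by lra.
  have h2 : (2 / 3 : R) < 1 by lra.
  rewrite exprD; apply: (@le_trans _ _ (#|S|%:R * #|S'|%:R)); last first.
    by rewrite ler_pM//; exact: lattice_count h1 h2.
  rewrite -natrM ler_nat mulnC -cardsX subset_leq_card//.
  by apply/fintype.subsetP => -[k' k]; rewrite !inE/= => /and4P[-> ->].
- move=> w Bw k' k k1' k1 k2' k2.
  rewrite -/(pt k) -/(pt' k') -(fE (k', k)) -/a leNgt; apply/negP => /ltW lt; apply: Bw.
  have kS : (k', k) \in SS by rewrite !inE/= k1' k1/=; apply/andP; split.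
  by rewrite (bigD1 (k', k))//=; left.
Qed.

End noise.

End concentration.

(** * Degenerate dimensions and the final assembly *)

Lemma specnorm_degenerate {R : realType} {p q : nat} (A : 'M[R]_(p, q)) (c : R) :
  (p == 0%N) || (q == 0%N) -> 0 <= c -> specnorm A <= c.
Proof.
move=> pq0 c0; apply: specnorm_le => // u v u1 v1.
have dot0 k (x : 'cV[R]_k) : k == 0%N -> dot x x = 1 -> False.
  move=> /eqP k0; subst k; rewrite /dot big_ord0 => /esym/eqP.
  by rewrite oner_eq0.
by case/orP: pq0 => h; [case: (dot0 _ u)|case: (dot0 _ v)].
Qed.

Lemma lambda_min_0 {R : realType} (A : 'M[R]_0) : lambda_min A = 0.
Proof.
rewrite /lambda_min (_ : [set a | eigenvalue A a] = set0) ?inf0//.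
apply/seteqP; split => // a /= /eigenvalueP[v _ /eqP]; apply.
by apply/matrixP => i [].
Qed.

Lemma least_squares_concentration (R : realType) (d : measure_display) (T : measurableType d)
  (P : probability T R) (n l : nat) (Theta : 'M[R]_(l.+1, n.+1))
  (sx se muhat delta : R) (mu : nat -> 'cV[R]_n.+1)
  (X : nat -> 'I_n.+1 -> {RV P >-> R}) (E : nat -> 'I_l.+1 -> {RV P >-> R}) (t : nat) :
  0 < sx -> 0 < se -> 0 <= muhat -> (0 < t)%N ->
  (forall j, vnorm (mu j) <= muhat) ->
  (forall j k A, measurable A -> distribution P (X j k) A = normal_prob (mu j k 0) sx A) ->
  (forall j m A, measurable A -> distribution P (E j m) A = normal_prob 0 se A) ->
  indep_RVs P (coord_family X E) ->
  0 < delta -> delta <= 4^-1 ->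
  8 * n.+1%:R + 16 * ln (2 / delta) <= t%:R ->
  (16 * muhat * (Num.sqrt (4 * n.+1%:R) + Num.sqrt (2 * ln (2 / delta))) / sx) ^+ 2 <= t%:R ->
  exists A : set T, measurable A /\
    A `<=` [set w | specnorm (Thetahat Theta X E t w - Theta)
      <= 8 * se * (4 * sx * Num.sqrt ((n.+1 + l.+1)%:R * ln (9 / delta))
             + muhat * (Num.sqrt (2 * (l.+1 + n.+1)%:R) + 2 * Num.sqrt (ln (2 / delta))))
         / (Num.sqrt t%:R * sx ^+ 2 * lambda_min (1%:M + mubar mu sx t))] /\
    ((1 - 4 * delta)%:E <= P A)%E.
Proof.
move=> sx0 se0 muhat0 t0 mub Xlaw Elaw XEind delta0 delta1 tn tmu.
set lam := lambda_min _.
have lam1 : 1 <= lam := lambda_min_regularized_ge1 mu sx0 t0.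
have lam0 : 0 < lam by exact: lt_le_trans lam1.
pose V := t%:R * sx ^+ 2.
have V0 : 0 < V by rewrite mulr_gt0 ?ltr0n ?exprn_gt0.
pose Lam := V / 32 * lam.
have Lam0 : 0 < Lam by rewrite mulr_gt0// divr_gt0.
have [B1 [mB1 PB1 HB1]] := trace_event sx0 se0 Xlaw Elaw XEind delta0 tn.
have [B2 [mB2 PB2 HB2]] := lattice_event sx0 se0 Xlaw Elaw XEind delta0 delta1 tn.
have [B3 [mB3 PB3 HB3]] := cross_event sx0 se0 muhat0 t0 mub Xlaw Elaw XEind delta0 delta1 tmu.
have [B4 [mB4 PB4 HB4]] := frobenius_event t sx0 se0 Xlaw Elaw XEind delta0 delta1 Lam0.
have [B5 [mB5 PB5 HB5]] := operator_event t sx0 se0 Xlaw Elaw XEind delta0 delta1 Lam0.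
pose B := B1 `|` (B2 `|` (B3 `|` (B4 `|` B5))).
have mB : measurable B by do 4 (apply: measurableU => //).
exists (~` B); split; first exact: measurableC.
split; last first.
  rewrite probability_setC// EFinB leeB//.
  (* The total 2 (delta/2)^2 + 3 delta is at most 4 delta for [delta] at most 1/4. *)
  have le2 : (P B <= ((delta / 2) ^+ 2)%:E + (((delta / 2) ^+ 2)%:E + (delta%:E + (delta%:E + delta%:E))))%E.
    have PU (A1 A2 : set T) (a1 a2 : \bar R) : measurable A1 -> measurable A2 ->
        (P A1 <= a1 -> P A2 <= a2 -> P (A1 `|` A2) <= a1 + a2)%E.
      by move=> m1 m2 h1 h2; apply: le_trans (measureU2 _ m1 m2) (leeD h1 h2).
    have m45 := measurableU _ _ mB4 mB5; have m345 := measurableU _ _ mB3 m45.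
    have m2345 := measurableU _ _ mB2 m345.
    by do 4 (apply: (PU) => //).
  apply: le_trans le2 _; rewrite -!EFinD lee_fin.
  by move: delta0 delta1; clear; nra.
move=> w /= Bw.
have nB1 : ~ B1 w by move=> h; apply: Bw; left.
have nB2 : ~ B2 w by move=> h; apply: Bw; right; left.
have nB3 : ~ B3 w by move=> h; apply: Bw; do 2 right; left.
have nB4 : ~ B4 w by move=> h; apply: Bw; do 3 right; left.
have nB5 : ~ B5 w by move=> h; apply: Bw; do 4 right.
have low := lattice_lower_bound (ltn0Sn n) (ltW V0) (HB1 w nB1) (HB2 w nB2).
have design := design_lower_bound (ltW V0) low (HB3 w nB3).
pose x (j : 'I_t) := xvec X j w.
(* In the Rayleigh inequality scaled by [V / 32], the mean part becomes [s / 8], which is covered by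
   the full [s] in [design]. *)
have xlow v : Lam * dot v v <= \sum_j dot (x j) v ^+ 2.
  have := lambda_min_regularized_rayleigh mu sx0 t0 v; rewrite -/lam -/V => ray.
  have V32 : 0 <= V / 32 by rewrite divr_ge0// ltW.
  have := ler_wpM2l V32 ray; rewrite mulrA -/Lam => h; apply: le_trans h _.
  have -> : \sum_j dot (x j) v ^+ 2 = \sum_(j < t) dot (mu j + deviation mu X j w) v ^+ 2.
    by apply: eq_bigr => j _; rewrite -xvec_deviation.
  apply: le_trans (design v); rewrite mulrDr lerD2l.
  set s := \sum_(j < t) _; have s0 : 0 <= s by apply: sumr_ge0 => j _; rewrite sqr_ge0.
  have -> : V / 32 * (4 / V * s) = s / 8 by field; rewrite gt_eqF.
  by lra.
have gu : gram x \in unitmx.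
  by apply: (positive_unitmx Lam0 (gram_sym x)) => v; rewrite dot_gram.
pose eta (j : 'I_t) := xvec E j w.
have -> : Thetahat Theta X E t w - Theta = \sum_j eta j *m (invmx (gram x) *m x j)^T.
  exact: (least_squares_error Theta eta gu).
set D := \sum_j _.
(* On the good event [xlow] makes the truncation in [noise_weight] inactive. *)
have nwE v (j : 'I_t) : noise_weight X t Lam v j w = dot (invmx (gram x) *m x j) v.
  by rewrite /noise_weight/= ifT//; exact: dot_sqr_sum_invmx_gram.
have dotD u v : dot u (D *m v) = \sum_a \sum_(j < t) u a 0 * noise_weight X t Lam v j w * E j a w.
  rewrite mulmx_suml dot_sumr [RHS]exchange_big; apply: eq_bigr => j _ /=.
  have uE : dot u (eta j) = \sum_a u a 0 * E j a w by apply: eq_bigr => a _; rewrite mxE.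
  rewrite mulmx_outer dotZr uE mulr_sumr; apply: eq_bigr => a _.
  by rewrite nwE mulrCA mulrA.
have L0 : 0 <= ln (1 / delta) by rewrite ln_ge0// ler_pdivlMr// mul1r; move: delta1; lra.
have LL2 : ln (1 / delta) <= ln (2 / delta).
  by rewrite ler_ln ?posrE ?divr_gt0// ler_pM2r ?invr_gt0//; lra.
have L9 : 0 <= (n.+1 + l.+1)%:R * ln (9 / delta).
  by rewrite mulr_ge0// ln_ge0// ler_pdivlMr// mul1r; move: delta1; lra.
have den0 : 0 < Num.sqrt t%:R * sx ^+ 2 * lam.
  by rewrite !mulr_gt0 ?sqrtr_gt0 ?ltr0n ?exprn_gt0.
apply: specnorm_le => [|u v u1 v1].
  rewrite divr_ge0 ?(ltW den0)// !mulr_ge0 ?(ltW se0)// addr_ge0//.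
    by rewrite !mulr_ge0 ?(ltW sx0) ?sqrtr_ge0.
  by rewrite mulr_ge0// addr_ge0 ?mulr_ge0 ?sqrtr_ge0.
apply: (@error_rate_arithmetic R n.+1 l.+1 t sx se muhat (ln (1 / delta)) (ln (2 / delta))
    ((n.+1 + l.+1)%:R * ln (9 / delta)) lam) => //.
- exact: lambda_min_regularized_le.
- apply: lattice_operator_bound u1 v1 => // k' k k1' k1 k2' k2.
  by rewrite dotD; exact: HB5.
have frob : dot u (D *m v) ^+ 2 <=
    (se / Num.sqrt Lam * (Num.sqrt n.+1%:R * (Num.sqrt l.+1%:R + Num.sqrt (2 * ln (1 / delta))))) ^+ 2.
  apply: le_trans (cauchy_schwarz _ _) _; rewrite u1 mul1r.
  apply: le_trans (frobenius_bound _ _) _; rewrite v1 mulr1 exchange_big/=.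
  rewrite [leRHS]exprMn expr_div_n [X in _ * X]exprMn !sqr_sqrtr ?(ltW Lam0)// mulrA.
  have -> : se ^+ 2 / Lam * n.+1%:R = se ^+ 2 * n.+1%:R / Lam by rewrite mulrAC.
  apply: le_trans (HB4 w nB4); rewrite le_eqVlt; apply/orP; left; apply/eqP.
  apply: eq_bigr => i _; apply: eq_bigr => a _; congr (_ ^+ 2).
  rewrite summxE; apply: eq_bigr => j _.
  by rewrite nwE dot_delta mxE big_ord1 !mxE mulrC.
set b := _ * _ in frob *.
have b0 : 0 <= b.
  by rewrite !mulr_ge0 ?invr_ge0 ?sqrtr_ge0 ?(ltW se0)// addr_ge0 ?sqrtr_ge0.
apply: le_trans (ler_norm _) _.
by rewrite -[leLHS]ger0_norm// -sqrtr_sqr -[leRHS]ger0_norm// -[leRHS]sqrtr_sqr real_normK ?num_real// ler_wsqrtr.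
Qed.

Theorem theorem1 (R : realType) (d : measure_display) (T : measurableType d)
  (P : probability T R) (n l : nat) (Theta : 'M[R]_(l, n))
  (sx se muhat delta : R) (mu : nat -> 'cV[R]_n)
  (X : nat -> 'I_n -> {RV P >-> R}) (E : nat -> 'I_l -> {RV P >-> R}) (t : nat) :
  0 < sx -> 0 < se -> 0 <= muhat ->
  (forall j, vnorm (mu j) <= muhat) ->
  (forall j k A, measurable A -> distribution P (X j k) A = normal_prob (mu j k 0) sx A) ->
  (forall j m A, measurable A -> distribution P (E j m) A = normal_prob 0 se A) ->
  indep_RVs P (coord_family X E) ->
  0 < delta ->
  8 * n%:R + 16 * ln (2 / delta) <= t%:R ->
  (16 * muhat * (Num.sqrt (4 * n%:R) + Num.sqrt (2 * ln (2 / delta))) / sx) ^+ 2 <= t%:R ->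
  2 * (n + l)%:R * ln (1 / delta) <= t%:R ->
  let C1 := 8 * se * (4 * sx * Num.sqrt ((n + l)%:R * ln (9 / delta))
             + muhat * (Num.sqrt (2 * (l + n)%:R) + 2 * Num.sqrt (ln (2 / delta)))) in
  exists A : set T, measurable A /\
    A `<=` [set w | specnorm (Thetahat Theta X E t w - Theta)
                     <= C1 / (Num.sqrt t%:R * sx ^+ 2 * lambda_min (1%:M + mubar mu sx t))] /\
    ((1 - 4 * delta)%:E <= P A)%E.
Proof.
move=> sx0 se0 muhat0 mub Xlaw Elaw XEind delta0 tn tmu _ C1.
(* For [delta] above 1/4 the required probability is negative, so the empty event will do. *)
have [delta1|delta1] := leP delta 4^-1; last first.
  exists set0; split; first exact: measurable0.
  by split; [exact: sub0set|rewrite measure0 lee_fin; move: delta1; lra].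
have t0 : (0 < t)%N.
  rewrite -(ltr_nat R); apply: lt_le_trans tn.
  rewrite ltr_wpDl ?mulr_ge0// mulr_gt0// ln_gt0// ltr_pdivlMr// mul1r.
  by move: delta1; lra.
have C10 : 0 <= C1.
  rewrite !mulr_ge0 ?(ltW se0)// addr_ge0//.
    by rewrite !mulr_ge0 ?(ltW sx0) ?sqrtr_ge0.
  by rewrite mulr_ge0// addr_ge0 ?mulr_ge0 ?sqrtr_ge0.
have [nl0|] := boolP ((l == 0%N) || (n == 0%N)).
  exists setT; split; first exact: measurableT.
  split; last by rewrite probability_setT lee_fin; move: delta0; lra.
  move=> w _ /=; apply: specnorm_degenerate => //.
  rewrite divr_ge0// !mulr_ge0 ?sqrtr_ge0 ?exprn_ge0 ?(ltW sx0)//.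
  (* For [n = 0] there are no eigenvalues and [lambda_min] takes the default value 0 of [inf], so
     the right-hand side is a division by 0, that is 0; otherwise [lambda_min] is at least 1. *)
  case: n mu {X Theta tn tmu C1 C10 nl0 Xlaw XEind} mub => [|n] mu mub.
    by rewrite lambda_min_0.
  exact: le_trans ler01 (lambda_min_regularized_ge1 mu sx0 t0).
rewrite negb_or /C1; case: l E Theta Elaw XEind {C1 C10} => // l E Theta Elaw XEind.
case: n mu X Theta mub Xlaw XEind tn tmu => // n mu X Theta mub Xlaw XEind tn tmu _.
exact: least_squares_concentration.
Qed.
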